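(* Let $r\ge1$ and let $C\subset\mathbb{P}^{2r}$ be a rational normal curve. The dual variety $(\operatorname{Sec}_rC)^*\subset(\mathbb{P}^{2r})^*$ of the hypersurface $\operatorname{Sec}_rC\subset\mathbb{P}^{2r}$ is an isomorphic projection of the Veronese variety $V=\nu_2(\mathbb{P}^r)\subset\mathbb{P}^N$, $N=\binom{r+2}{2}-1$; that is, there is a linear projection from $\mathbb{P}^N$ to $(\mathbb{P}^{2r})^*$ whose restriction to $V$ is an isomorphism of $V$ onto $(\operatorname{Sec}_rC)^*$.
   Context: We work over $\mathbb{C}$. A rational normal curve $C\subset\mathbb{P}^{2r}$ is, up to projective equivalence, the image of the degree-$2r$ Veronese embedding of $\mathbb{P}^1$. $\operatorname{Sec}_rC$ is the closure of the union of the $(r-1)$-planes spanned by $r$ general points of $C$. $\nu_2:\mathbb{P}^r\hookrightarrow\mathbb{P}^N$ is the quadratic Veronese embedding. The dual variety $X^*$ of $X\subset\mathbb{P}^n$ is the closure in $(\mathbb{P}^n)^*$ of the set of hyperplanes tangent to $X$ at some nonsingular point. *)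

(* Defs.v *)
From HB Require Import structures.
From mathcomp Require Import all_boot all_order all_algebra.
From mathcomp Require Import classical_sets reals.
From mathcomp Require Import complex.
From mathcomp Require Import mpoly.

Set Implicit Arguments.
Unset Strict Implicit.
Unset Printing Implicit Defensive.

Import GRing.Theory.

Local Open Scope ring_scope.
Local Open Scope classical_set_scope.

(* The quadratic monomials X_i X_j, i <= j, in X_0, ..., X_r; they are the
   homogeneous coordinates of P^N, N = quad_dim r. *)
Definition quad_pairs (r : nat) : seq ('I_r.+1 * 'I_r.+1) :=
  [seq p : 'I_r.+1 * 'I_r.+1 <- enum {: 'I_r.+1 * 'I_r.+1} | (p.1 <= p.2)%N].

Definition quad_dim (r : nat) : nat := ('C(r.+2, 2)).-1.

Lemma size_quad_pairs r : size (quad_pairs r) = (quad_dim r).+1.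
Proof.
rewrite prednK ?bin_gt0 // size_filter -sum1_count big_enum_cond /=.
rewrite (eq_bigl (fun p : 'I_r.+1 * 'I_r.+1 => true && (p.1 <= p.2)%N)) //.
rewrite -(pair_big_dep xpredT (fun i j : 'I_r.+1 => (i <= j)%N)
                              (fun _ _ => 1%N)) /=.
rewrite (exchange_big_dep xpredT) //= -bin2_sum big_mkord big_ord_recl add0n.
apply: eq_bigr => j _.
transitivity (\sum_(i < j.+1) 1)%N.
  by rewrite (big_ord_widen r.+1 (fun=> 1%N) (ltn_ord j)); exact: eq_bigl.
by rewrite big_const_ord iter_addn_0 mul1n.
Qed.

Section ProjectiveGeometry.
Variable K : fieldType.

(* Points of P^n are the lines through 0 in K^(n+1).  The dual space (P^n)^* is
   also represented by [pspace n]: the line spanned by [a] is the hyperplane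
   [\sum_i a_i x_i = 0]. *)
Definition pspace (n : nat) := {L : {vspace 'rV[K]_n.+1} | \dim L == 1%N}.

Definition vanishes_at n (f : {mpoly K[n.+1]}) (x : pspace n) : Prop :=
  forall v : 'rV[K]_n.+1, v \in val x -> f.@[fun i => v 0 i] = 0.

Definition homogeneous n (f : {mpoly K[n.+1]}) : Prop :=
  exists d : nat, f \is d.-homog.

Definition zlocus n (E : set {mpoly K[n.+1]}) : set (pspace n) :=
  [set x | forall f, E f -> vanishes_at f x].

Definition zclosed n (Z : set (pspace n)) : Prop :=
  exists2 E : set {mpoly K[n.+1]}, E `<=` @homogeneous n & Z = zlocus E.

Definition zclosure n (S : set (pspace n)) : set (pspace n) :=
  [set x | forall Z : set (pspace n), zclosed Z -> S `<=` Z -> Z x].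

Definition zirreducible n (S : set (pspace n)) : Prop :=
  S !=set0 /\
  forall Z1 Z2 : set (pspace n), zclosed Z1 -> zclosed Z2 ->
    S `<=` Z1 `|` Z2 -> S `<=` Z1 \/ S `<=` Z2.

Definition closed_chain n (X : set (pspace n)) (d : nat) : Prop :=
  exists Z : nat -> set (pspace n),
    (forall i, (i <= d)%N -> [/\ zclosed (Z i), zirreducible (Z i) & Z i `<=` X])
    /\ (forall i, (i < d)%N -> Z i `<` Z i.+1).

(* Krull dimension of a closed subset [X] of P^n. *)
Definition has_dim n (X : set (pspace n)) (d : nat) : Prop :=
  closed_chain X d /\ forall e, closed_chain X e -> (e <= d)%N.

(* Affine cone over the embedded projective tangent space of [X] at [x]. *)
Definition tangent_vectors n (X : set (pspace n)) (x : pspace n) :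
    set 'rV[K]_n.+1 :=
  [set w | forall f : {mpoly K[n.+1]}, homogeneous f ->
     (forall y, X y -> vanishes_at f y) ->
     forall v : 'rV[K]_n.+1, v \in val x ->
       \sum_(i < n.+1) (f^`M(i)).@[fun j => v 0 j] * w 0 i = 0].

(* Meant for [X] closed and irreducible, where the local dimension at every
   point is the dimension of [X].  [T] is the affine cone, hence [d.+1]. *)
Definition nonsingular_at n (X : set (pspace n)) (x : pspace n) : Prop :=
  X x /\ exists (T : {vspace 'rV[K]_n.+1}) (d : nat),
    [/\ (forall w, w \in T <-> tangent_vectors X x w),
        has_dim X d & \dim T = d.+1].

Definition tangent_hyperplane n (X : set (pspace n)) (x h : pspace n) : Prop :=
  forall a w : 'rV[K]_n.+1, a \in val h -> tangent_vectors X x w ->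
    \sum_(i < n.+1) a 0 i * w 0 i = 0.

Definition dual_variety n (X : set (pspace n)) : set (pspace n) :=
  zclosure [set h | exists2 x, nonsingular_at X x & tangent_hyperplane X x h].

Definition veronese_curve_vec n (u : 'rV[K]_2) : 'rV[K]_n.+1 :=
  \row_(i < n.+1) (u ord0 ord0 ^+ (n - i) * u ord0 ord_max ^+ i).

Definition rational_normal_curve n (C : set (pspace n)) : Prop :=
  exists2 g : 'M[K]_n.+1, g \in unitmx &
    C = [set x | exists2 u : 'rV[K]_2, u != 0 &
                 val x = <[veronese_curve_vec n u *m g]>%VS].

(* The condition on [\dim] says that the [r] points span an (r-1)-plane; it is
   the generality required of them. *)
Definition secant_variety n (r : nat) (C : set (pspace n)) : set (pspace n) :=
  zclosure [set x | exists p : 'I_r -> pspace n,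
    [/\ forall i, C (p i),
        \dim (\sum_(i < r) val (p i))%VS = r &
        (val x <= \sum_(i < r) val (p i))%VS]].

Definition quad_veronese_vec r (u : 'rV[K]_r.+1) : 'rV[K]_(quad_dim r).+1 :=
  \row_k (let p := nth (ord0, ord0) (quad_pairs r) k in u 0 p.1 * u 0 p.2).

Definition quad_veronese (r : nat) : set (pspace (quad_dim r)) :=
  [set x | exists2 u : 'rV[K]_r.+1, u != 0 & val x = <[quad_veronese_vec u]>%VS].

Definition eval_forms n m (F : 'I_m.+1 -> {mpoly K[n.+1]}) (v : 'rV[K]_n.+1) :
    'rV[K]_m.+1 :=
  \row_i (F i).@[fun j => v 0 j].

(* Locally given by forms of the same degree; [~` Z] is the neighbourhood.  As
   [val (phi y)] has dimension 1, the forms have no common zero there. *)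
Definition regular_on n m (X : set (pspace n)) (phi : pspace n -> pspace m) :
    Prop :=
  forall x, X x ->
    exists (d : nat) (F : 'I_m.+1 -> {mpoly K[n.+1]}) (Z : set (pspace n)),
      [/\ forall i, F i \is d.-homog, zclosed Z, ~ Z x &
          forall y, X y -> ~ Z y ->
          forall v : 'rV[K]_n.+1, v \in val y -> v != 0 ->
            val (phi y) = <[eval_forms F v]>%VS].

(* [phi] is only relevant on [X], and its inverse [psi] only on [Y]. *)
Definition isomorphism_onto n m (X : set (pspace n)) (Y : set (pspace m))
    (phi : pspace n -> pspace m) : Prop :=
  exists psi : pspace m -> pspace n,
    [/\ forall x, X x -> Y (phi x) /\ psi (phi x) = x,
        forall y, Y y -> X (psi y) /\ phi (psi y) = y,
        regular_on X phi & regular_on Y psi].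

(* The projection with centre P(ker A), for [A] surjective on row vectors; since
   [val (phi x)] is a line, this forces [X] to avoid the centre. *)
Definition restricts_projection n m (A : 'M[K]_(n.+1, m.+1)) (X : set (pspace n))
    (phi : pspace n -> pspace m) : Prop :=
  forall x, X x -> val (phi x) = (linfun (mulmxr A) @: val x)%VS.

End ProjectiveGeometry.

(* Main.v *)
(* Points of the secant variety X are limits of y = sum_i l_i nu(t_i) (l_i <> 0, t_i distinct).
   If f vanishes on X, differentiating f(y) = 0 in l_i and t_i shows that the gradient of f at y,
   read as a binary form of degree 2r, vanishes doubly at every t_i, so it is a multiple of
   q^2 with q = prod_i (T - t_i).  For the Hankel determinant the gradient is nonzero, so y is
   nonsingular with tangent hyperplane q^2.  At any nonsingular point the tangent hyperplane is
   the gradient of some f, and "being a square of a form of degree r" is a closed condition,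
   so this gradient is a square as well.  Hence X^* consists of the squares q^2, whose
   coefficients are linear in the products q_i q_j.  Near a point with q(c) <> 0 the Taylor
   coefficients at c of q / q(c) are polynomials in those of q^2 / q(c)^2; this gives both the
   equations of the set of squares and the regular inverse. *)
Require Import Defs.
From mathcomp Require Import all_boot all_order all_algebra.
From mathcomp Require Import boolp classical_sets reals.
From mathcomp Require Import complex mpoly zify.

Set Implicit Arguments.
Unset Strict Implicit.
Unset Printing Implicit Defensive.

Import Order.TTheory GRing.Theory Num.Theory.

Local Open Scope ring_scope.
Local Open Scope classical_set_scope.

Local Notation ev f v := (meval (fun i => fun_of_matrix v 0 i) f).

(** * Evaluation along polynomial curves *)

Section Curves.
Variable K : fieldType.

(** Density and limits are treated algebraically. A polynomial is restricted to a curve along which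
    the parameters move into general position; the resulting univariate polynomial vanishes off
    finitely many parameters, hence is zero, hence vanishes at the special parameter too.
    Nonsingularity compares the tangent space with the Krull dimension, so the dimension 2r - 1 of
    the secant variety must be known exactly. The lower bound is an explicit chain of irreducible
    sets. The upper bound is a count: a long chain of primes yields more independent polynomials of
    bounded degree than there are monomials. The ideal of the secant variety is never determined. At
    a general point the gradients of all its members are multiples of one vector, and the Hankel
    determinant supplies a nonzero one. It lies in the ideal because the Hankel matrix of a
    combination of r points of the curve has rank at most r, while its size is r + 1. *)

Definition curve_at n (y : 'rV[{poly K}]_n) (e : K) : 'rV[K]_n :=
  \row_i (y 0 i).[e].

Definition along n (f : {mpoly K[n]}) (y : 'rV[{poly K}]_n) : {poly K} :=
  mmap polyC (fun i => y 0 i) f.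

Lemma horner_along n (f : {mpoly K[n]}) y e :
  (along f y).[e] = ev f (curve_at y e).
Proof.
rewrite /along /meval /mmap horner_sum; apply: eq_bigr => m _.
rewrite hornerM hornerC /= /mmap1 horner_prod; congr (_ * _).
by apply: eq_bigr => i _; rewrite horner_exp mxE.
Qed.

(** Chain rule. Both sides are additive in [f] and obey the Leibniz rule, so constants and variables
    suffice. *)
Lemma deriv_along n (f : {mpoly K[n]}) y :
  (along f y)^`() = \sum_i along f^`M(i) y * (y 0 i)^`().
Proof.
have alongD p q : along (p + q) y = along p y + along q y by rewrite /along mmapD.
have alongM p q : along (p * q) y = along p y * along q y by rewrite /along rmorphM.
pose P p := (along p y)^`() = \sum_i along p^`M(i) y * (y 0 i)^`().
have P0 c : P c%:MP.
  rewrite /P /along mmapC derivC big1 // => i _.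
  by rewrite mderivC mmap0 mul0r.
have PD p q : P p -> P q -> P (p + q).
  rewrite /P => Hp Hq; rewrite alongD derivD Hp Hq -big_split.
  by apply: eq_bigr => i _; rewrite mderivD alongD mulrDl.
have PM p q : P p -> P q -> P (p * q).
  rewrite /P => Hp Hq; rewrite alongM derivM Hp Hq mulr_suml mulr_sumr -big_split.
  apply: eq_bigr => i _; rewrite mderivM alongD !alongM mulrDl.
  by rewrite mulrAC !mulrA.
have PX i : P 'X_i.
  rewrite /P /along mmapX mmap1U (bigD1 i) //= mderivX mnm1E eqxx scale1r.
  have -> : (U_(i) - U_(i))%MM = 0%MM :> 'X_{1..n} by apply/mnmP => j; rewrite mnmBE subnn mnm0E.
  rewrite mmapX mmap11 mul1r big1 ?addr0 // => j ji.
  by rewrite mderivX mnm1E eq_sym (negPf ji) scale0r mmap0 mul0r.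
elim/mpolyind: f => [|c m p _ _ Hp]; first by rewrite -mpolyC0; exact: P0.
apply: PD Hp; rewrite -mul_mpolyC; apply: (PM _ _ (P0 _)).
rewrite mpolyXE_id; apply: (big_ind P) => [|//|i _]; first by rewrite -mpolyC1.
by elim: (m i) => [|k IH]; rewrite ?expr0 -?mpolyC1 // exprS; exact: PM.
Qed.

Lemma horner_deriv_along n (f : {mpoly K[n]}) y e :
  (along f y)^`().[e] =
  \sum_i ev f^`M(i) (curve_at y e) * (curve_at (map_mx (@deriv K) y) e) 0 i.
Proof.
rewrite deriv_along horner_sum; apply: eq_bigr => i _.
by rewrite hornerM horner_along !mxE.
Qed.

Lemma alongM n (f g : {mpoly K[n]}) y : along (f * g) y = along f y * along g y.
Proof. by rewrite /along rmorphM. Qed.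

End Curves.

Section InfiniteField.
Variable K : numFieldType.

Lemma poly_nonroot (p : {poly K}) : p != 0 -> exists c, p.[c] != 0.
Proof.
move=> p0; apply: contrapT => H.
have := max_poly_roots p0 (rs := [seq i%:R | i <- iota 0 (size p)]).
rewrite size_map size_iota ltnn => F; suff: false by []; apply: F.
  apply/allP => c _; apply/negPn/negP => cn; apply: H; exists c.
  by rewrite -rootE.
rewrite map_inj_uniq ?iota_uniq // => i j /eqP.
by rewrite eqr_nat => /eqP.
Qed.

(** Stands in for density: [B] collects the bad parameters, and [B * along f y] vanishes at every
    point of an infinite field. *)
Lemma along_eq0 n (f : {mpoly K[n]}) (y : 'rV[{poly K}]_n) (B : {poly K}) :
  B != 0 -> (forall e, B.[e] != 0 -> ev f (curve_at y e) = 0) -> along f y = 0.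
Proof.
move=> B0 H; apply/eqP; rewrite -(mulrI_eq0 _ (mulfI B0)); apply/negPn/negP.
move=> /poly_nonroot [c]; rewrite hornerM mulf_eq0 negb_or => /andP[/H].
by rewrite horner_along => ->; rewrite eqxx.
Qed.

End InfiniteField.

(** * Zariski closed sets *)

Section Projective.
Variable K : numFieldType.
Variable n : nat.
Implicit Types (x : pspace K n) (f : {mpoly K[n.+1]}) (v : 'rV[K]_n.+1).

Lemma pspace_gen x : exists2 v, v != 0 & val x = <[v]>%VS.
Proof.
have x0 : val x != 0%VS by rewrite -dimv_eq0 (eqP (valP x)).
exists (vpick (val x)); first by rewrite vpick0.
apply/eqP; rewrite eq_sym eqEdim -memvE memv_pick (eqP (valP x)).
by rewrite dim_vline vpick0 x0.
Qed.

Lemma pline_proof v : v != 0 -> \dim <[v]> == 1%N.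
Proof. by move=> v0; rewrite dim_vline v0. Qed.

Definition pline v (v0 : v != 0) : pspace K n :=
  exist (fun L : {vspace 'rV[K]_n.+1} => \dim L == 1%N) <[v]>%VS (pline_proof v0).

Lemma val_line_neq0 x v : val x = <[v]>%VS -> v != 0.
Proof.
by move=> xv; have := valP x; rewrite xv dim_vline; case: (v != 0).
Qed.

Lemma dhomog_scale d f c v : f \is d.-homog -> ev f (c *: v) = c ^+ d * ev f v.
Proof.
move=> /dhomogP fd; have {}fd m : m \in msupp f -> mdeg m = d := fd m.
rewrite !mevalE mulr_sumr big_seq [RHS]big_seq.
apply: eq_bigr => m /fd <-; rewrite mulrCA; congr (_ * _).
rewrite mdegE -prodrXr -big_split; apply: eq_bigr => i _ /=.
by rewrite mxE exprMn.
Qed.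

Lemma vanishes_line f x v :
  homogeneous f -> val x = <[v]>%VS -> vanishes_at f x <-> ev f v = 0.
Proof.
move=> [d fd] xv; split=> [|fv w]; first by apply; rewrite xv memv_line.
by rewrite xv => /vlineP [c ->]; rewrite (dhomog_scale _ _ fd) fv mulr0.
Qed.

(** On the multiples of a vector [v], [f] becomes a polynomial in the scalar whose coefficients are
    the values at [v] of the homogeneous components. *)
Lemma vanishes_pihomog f x : vanishes_at f x -> forall d, vanishes_at (pihomog mdeg d f) x.
Proof.
move=> fx d v vx.
pose g d := pihomog mdeg d f.
have gd e : g e \is e.-homog by exact: pihomogP.
pose p := \poly_(e < msize f) (ev (g e) v).
have fE w : ev f w = \sum_(e < msize f) ev (g e) w.
  by rewrite {1}[f](pihomog_partitionE (mf := mdeg) (leqnn _)) raddf_sum.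
have p0 : p = 0.
  apply/eqP/negPn/negP => /poly_nonroot [c /eqP]; apply.
  rewrite -(fx (c *: v)) ?memvZ // fE horner_poly; apply: eq_bigr => e _.
  by rewrite (dhomog_scale _ _ (gd e)) mulrC.
have [dl|dl] := ltnP d (msize f).
  by have := coef_poly (msize f) (fun e => ev (g e) v) d; rewrite -/p p0 coef0 dl.
suff -> : pihomog mdeg d f = 0 by rewrite meval0.
rewrite pihomogE big1_seq // => m /andP[/eqP md /msize_mdeg_lt].
by rewrite md ltnNge dl.
Qed.

(** Closed sets are cut out by homogeneous equations; arbitrary equations can be replaced by their
    homogeneous components. *)
Lemma zlocus_zclosed (E : set {mpoly K[n.+1]}) : zclosed (zlocus E).
Proof.
exists [set g | exists d f, E f /\ g = pihomog mdeg d f].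
  by move=> _ [d [f [_ ->]]]; exists d; exact: pihomogP.
apply/seteqP; split=> x /= Hx.
  by move=> _ [d [f [Ef ->]]]; apply: vanishes_pihomog; exact: Hx.
move=> f Ef v vx.
rewrite [f](pihomog_partitionE (mf := mdeg) (leqnn _)) raddf_sum big1 //= => e _.
by apply: (Hx _ _ v vx); exists e, f.
Qed.

Lemma subset_zclosure (S : set (pspace K n)) : S `<=` zclosure S.
Proof. by move=> x Sx Z _; apply. Qed.

Lemma zclosure_zclosed (S : set (pspace K n)) : zclosed (zclosure S).
Proof.
exists [set f | homogeneous f /\ forall x, S x -> vanishes_at f x].
  by move=> f [].
apply/seteqP; split=> x Hx /=.
  apply: Hx => [|y Sy f [_]]; last exact.
  by exists [set f | homogeneous f /\ forall x, S x -> vanishes_at f x] => // f [].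
move=> Z [E Eh ->] SE f Ef; apply: Hx; split; first exact: Eh.
by move=> y /SE; exact.
Qed.

Lemma vanishes_zclosure f (S : set (pspace K n)) :
  (forall x, S x -> vanishes_at f x) -> forall x, zclosure S x -> vanishes_at f x.
Proof.
move=> Sf x /(_ (zlocus [set f]) (zlocus_zclosed _)) H; apply: H => //.
by move=> y Sy _ ->; exact: Sf.
Qed.

(** Restricted to the line of [x], both factors lie in a univariate polynomial ring, which is a
    domain; homogeneity plays no part. *)
Lemma vanishes_mul f g x :
  vanishes_at (f * g) x -> vanishes_at f x \/ vanishes_at g x.
Proof.
have [v v0 xv] := pspace_gen x; move=> fg.
pose y : 'rV[{poly K}]_n.+1 := \row_i (v 0 i *: 'X).
have yE e : curve_at y e = e *: v.
  by apply/rowP => i; rewrite !mxE hornerZ hornerX mulrC.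
have van h : along h y = 0 -> vanishes_at h x.
  move=> hy w; rewrite xv => /vlineP [c ->].
  by rewrite -yE -horner_along hy horner0.
have : along f y * along g y = 0.
  rewrite -alongM; apply: (@along_eq0 _ _ _ _ 1); first exact: oner_neq0.
  by move=> e _; apply: fg; rewrite yE xv memvZ // memv_line.
by move/eqP; rewrite mulf_eq0 => /orP[] /eqP /van; [left|right].
Qed.

(** If neither closed set suffices, some equation of each fails at a vector of [P]. Along a curve in
    [P] joining these two vectors the product of the equations is zero although neither factor
    is. *)
Lemma irreducible_of_curves (P : set 'rV[K]_n.+1) :
  (exists2 v, P v & v != 0) ->
  (forall v w, P v -> P w -> exists y : 'rV[{poly K}]_n.+1,
     [/\ curve_at y 0 = v, curve_at y 1 = w & forall e, P (curve_at y e)]) ->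
  zirreducible (zclosure [set x : pspace K n | exists2 v, P v & val x = <[v]>%VS]).
Proof.
move=> [v0 Pv0 v0n] Pcurve; set S := [set x | _].
have Scl : S `<=` zclosure S := @subset_zclosure S.
split.
  by exists (pline v0n); apply: Scl; exists v0.
move=> Z1 Z2 Z1c Z2c SZ.
have sub Z : zclosed Z -> ~ (zclosure S `<=` Z) ->
    exists f v, [/\ P v, v != 0, ev f v != 0 & forall x, Z x -> vanishes_at f x].
  move=> [E Eh ->] /existsNP [x] /not_implyP [Sx] /existsNP [f] /not_implyP [Ef fx].
  have : ~ forall x, S x -> vanishes_at f x.
    by move=> H; apply: fx; apply: (vanishes_zclosure H).
  move=> /existsNP [z] /not_implyP [[v Pv zv] fz]; exists f, v; split=> //.
  - exact: val_line_neq0 zv.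
  - by apply/eqP => fv; apply: fz; apply/(vanishes_line (Eh _ Ef) zv).
  - by move=> w; apply.
apply: contrapT => /not_orP [/(sub _ Z1c) [f [v [Pv vn fv fZ]]]].
move=> /(sub _ Z2c) [g [w [Pw wn gw gZ]]].
have [y [y0 y1 yP]] := Pcurve _ _ Pv Pw.
have [i vi] : exists i, v 0 i != 0 by apply/rV0Pn.
(* The curve may pass through 0, where there is no projective point. The factor ['X_i] covers that
   case, and it is not zero along the curve because it is nonzero at [v]. *)
have : along (f * g * 'X_i) y = 0.
  apply: (@along_eq0 _ _ _ _ 1); first exact: oner_neq0.
  move=> e _; rewrite !mevalM mevalXU.
  have [->|yn] := eqVneq (curve_at y e) 0; first by rewrite mxE mulr0.
  have ye : curve_at y e \in val (pline yn) by rewrite memv_line.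
  have : S (pline yn) by exists (curve_at y e).
  move=> /Scl/SZ [/fZ/(_ _ ye) ->|/gZ/(_ _ ye) ->]; by rewrite ?mul0r ?mulr0 ?mul0r.
move/eqP; rewrite !alongM !mulf_eq0 => /orP[/orP[]|] /eqP h.
- by move: fv; rewrite -y0 -horner_along h horner0 eqxx.
- by move: gw; rewrite -y1 -horner_along h horner0 eqxx.
- by move: vi; rewrite -y0 -(mevalXU (fun i => curve_at y 0 0 i)) -horner_along h horner0 eqxx.
Qed.

End Projective.

(** * Krull dimension *)

Section KrullDimension.
Variables (K : fieldType) (n : nat).
Local Notation S := {mpoly K[n]}.
Implicit Types (J : set S) (f : S).

Definition prime_ideal J :=
  [/\ J 0, forall f g, J f -> J g -> J (f + g), forall f g, J g -> J (f * g),
      ~ J 1 & forall f g, J (f * g) -> J f \/ J g].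

(** Linear independence over [K] of the classes modulo [J]. *)
Definition free_mod (T : finType) (J : set S) (g : T -> S) :=
  forall a : T -> K, J (\sum_t a t *: g t) -> forall t, a t = 0.

(** In a relation modulo [J], the lowest power of [f] cancels because [J] is prime and misses [f].
    Reducing modulo [J'], which contains [f], then leaves a relation among the [g t] alone. *)
Lemma free_mod_pow (T : finType) J J' (g : T -> S) f D :
  prime_ideal J -> prime_ideal J' -> J `<=` J' -> J' f -> ~ J f ->
  free_mod J' g ->
  free_mod J (fun p : T * 'I_D => g p.1 * f ^+ p.2).
Proof.
move=> [J0 JD JM J1 Jp] [J'0 J'D J'M _ _] JJ' J'f Jf gf a.
pose s (k : 'I_D) := \sum_t a (t, k) *: g t.
have sumE : \sum_p a p *: (g p.1 * f ^+ p.2) = \sum_(k < D) s k * f ^+ k.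
  rewrite /s; under [RHS]eq_bigr do rewrite mulr_suml.
  rewrite exchange_big pair_bigA; apply: eq_bigr => -[t k] _ /=.
  by rewrite scalerAl.
rewrite sumE => Js [t k]; move: k t.
suff H m : forall k : 'I_D, (k < m)%N -> forall t, a (t, k) = 0.
  by move=> k t; apply: (H k.+1).
elim: m => // m IH k; rewrite ltnS leq_eqVlt => /orP[/eqP km|/IH//].
apply: gf; rewrite -/(s k).
pose rest := \sum_(l < D | (m < l)%N) s l * f ^+ (l - m).-1.
have E : \sum_(l < D) s l * f ^+ l = f ^+ m * (s k + f * rest).
  rewrite (bigID (fun l : 'I_D => (l < m)%N)) /= big1 ?add0r => [|l lm]; last first.
    by rewrite /s big1 ?mul0r // => t _; rewrite (IH _ lm) scale0r.
  rewrite (bigD1 k) /= ?km ?ltnn // mulrDr mulrC; congr (_ + _).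
  rewrite !mulr_sumr; apply: eq_big => [l|l].
    by rewrite -leqNgt ltn_neqAle andbC -(inj_eq val_inj) /= km [l == m :> nat]eq_sym.
  rewrite -leqNgt -(inj_eq val_inj) /= km => /andP[ml lm].
  have ml' : (m < l)%N by rewrite ltn_neqAle eq_sym lm.
  rewrite [f * _]mulrCA -exprS prednK ?subn_gt0 // [RHS]mulrCA -exprD subnKC //.
have : J (s k + f * rest).
  move: Js; rewrite E; elim: (m) => [|i IHi]; first by rewrite expr0 mul1r.
  by rewrite exprS -mulrA => /Jp [].
move=> /JJ' H.
have -> : s k = (s k + f * rest) + (- rest) * f by rewrite mulNr mulrC addrK.
by apply: J'D => //; apply: J'M.
Qed.

(** Degrees below [s] involve only monomials with all exponents below [s], of which there are
    [s ^ n]; independence makes the coefficient matrix of full row rank. *)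
Lemma free_mod_card (T : finType) (g : T -> S) s :
  free_mod [set 0] g -> (forall t, msize (g t) <= s)%N -> (#|T| <= s ^ n)%N.
Proof.
move=> gf gs.
pose M := \matrix_(i < #|T|, j < #|{ffun 'I_n -> 'I_s}|)
  (g (enum_val i))@_[multinom (enum_val j k : nat) | k < n].
suff : row_free M.
  by rewrite /row_free => /eqP <-; rewrite (leq_trans (rank_leq_col _)) ?card_ffun ?card_ord.
apply: inj_row_free => v vM.
have sum0 : \sum_t v 0 (enum_rank t) *: g t = 0.
  apply/mpolyP => m; rewrite mcoeff0 raddf_sum /=.
  have [ms|ms] := ltnP (mdeg m) s; last first.
    rewrite big1 // => t _; rewrite mcoeffZ [X in _ * X](_ : _ = 0) ?mulr0 //.
    by apply: memN_msupp_eq0; apply: msize_mdeg_ge; rewrite (leq_trans (gs t)).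
  have mk k : (m k < s)%N.
    by apply: leq_ltn_trans ms; rewrite mdegE (bigD1 k) //= leq_addr.
  pose j := enum_rank [ffun k => Ordinal (mk k)].
  transitivity ((v *m M) 0 j); last by rewrite vM mxE.
  rewrite mxE [RHS](reindex enum_rank) /=; last first.
    by exists enum_val => t _; [exact: enum_rankK|exact: enum_valK].
  apply: eq_bigr => t _; rewrite mcoeffZ mxE [enum_val (enum_rank t)](enum_rankK t).
  congr (_ * _@__); apply/mnmP => k; rewrite mnmE.
  by rewrite [enum_val j](enum_rankK [ffun k => Ordinal (mk k)]) ffunE.
apply/rowP => l; rewrite mxE -[l]enum_valK.
exact: (gf (fun t => v 0 (enum_rank t)) sum0).
Qed.

Lemma msize_mul_exp f g k : (msize (f * g ^+ k) <= msize f + k * (msize g).+1)%N.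
Proof.
elim: k => [|k IH]; first by rewrite expr0 mulr1 mul0n addn0.
rewrite exprSr mulrA (leq_trans (msizeM_le _ _)) // -addnS mulSnr addnA.
by rewrite leq_add2r.
Qed.

(* Multiplying by the powers below [D] of an element of [J i] outside [J i.+1] makes a family
   free modulo [J i] into a free family modulo [J i.+1] that is [D] times as large. *)
Lemma prime_chain_family (J : nat -> set S) m :
  (forall i, (i <= m)%N -> prime_ideal (J i)) ->
  (forall i, (i < m)%N -> J i.+1 `<` J i) ->
  exists M, forall D, (0 < D)%N -> exists (T : finType) (g : T -> S),
    [/\ #|T| = (D ^ m)%N, free_mod (J m) g & forall t, (msize (g t) <= M * D)%N].
Proof.
elim: m => [|m IH] Jp Js.
  exists 1%N => D D0; exists unit, (fun=> 1); split.
  - by rewrite card_unit.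
  - have [J0 _ JM J1 _] := Jp 0%N isT; move=> a; rewrite (big_pred1 tt) => [|[]//].
    move=> Ja t; apply/eqP/negPn/negP => at0; apply: J1.
    rewrite (_ : 1 = (a t)^-1%:MP * (a tt *: 1)); first exact: JM.
    by case: t at0 => at0; rewrite mul_mpolyC scalerA mulVf // scale1r.
  - by move=> _; rewrite msize1 mul1n.
have [||M HM] := IH.
- by move=> i im; apply: Jp; exact: leqW.
- by move=> i im; apply: Js; exact: leqW.
have [JJ /existsNP [f /not_implyP [Jf Jf']]] := Js m (leqnn _).
exists (M + (msize f).+1)%N => D D0; have [T [g [cT gf gs]]] := HM D D0.
exists (T * 'I_D)%type, (fun p : T * 'I_D => g p.1 * f ^+ p.2); split.
- by rewrite card_prod cT card_ord expnSr.
- exact: (free_mod_pow (Jp m.+1 (leqnn _)) (Jp m (leqnSn _))).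
- move=> [t k]; rewrite (leq_trans (msize_mul_exp _ _ _)) // mulnDl leq_add //.
  by rewrite mulnC leq_mul2l ltnW ?orbT.
Qed.

(* A free family of [D ^ m] polynomials of degree [O(D)] in [n] variables forces [m <= n]. *)
Theorem prime_chain_length (J : nat -> set S) m :
  (forall i, (i <= m)%N -> prime_ideal (J i)) ->
  (forall i, (i < m)%N -> J i.+1 `<` J i) -> (m <= n)%N.
Proof.
move=> Jp Js; have [M HM] := prime_chain_family Jp Js.
rewrite leqNgt; apply/negP => nm.
(* Independence bounds [D ^ m] by [(M * D) ^ n]; for [m > n] this would give [D <= M ^ n], so one
   more than [M ^ n] is enough. *)
pose D := (M ^ n).+1.
have [T [g [cT gf gs]]] := HM D (ltn0Sn _).
have [J0 _ _ _ _] := Jp m (leqnn _).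
have gf0 : free_mod [set 0] g by move=> a a0; apply: gf; rewrite a0.
have := free_mod_card gf0 gs; rewrite cT expnMn => H.
have : (D ^ n.+1 <= M ^ n * D ^ n)%N by rewrite (leq_trans _ H) // leq_pexp2l.
by rewrite expnS leq_pmul2r ?expn_gt0 // ltnn.
Qed.

End KrullDimension.

(** * Chains of irreducible closed subsets of a hypersurface *)

Section ProjectiveDimension.
Variables (K : numFieldType) (n : nat).

Definition cone_ideal (Z : set (pspace K n)) : set {mpoly K[n.+1]} :=
  [set f | forall x, Z x -> vanishes_at f x].

Lemma prime_cone_ideal (Z : set (pspace K n)) :
  zirreducible Z -> prime_ideal (cone_ideal Z).
Proof.
move=> [[z Zz] Zirr]; split.
- by move=> x _ v _; rewrite meval0.
- by move=> f g Zf Zg x Zx v vx; rewrite mevalD (Zf x Zx v vx) (Zg x Zx v vx) addr0.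
- by move=> f g Zg x Zx v vx; rewrite mevalM (Zg x Zx v vx) mulr0.
- move=> /(_ z Zz); have [v v0 zv] := pspace_gen z => /(_ v).
  by rewrite zv memv_line meval1 => /(_ isT)/eqP; rewrite oner_eq0.
- move=> f g Zfg.
  have [|H|H] := Zirr _ _ (zlocus_zclosed [set f]) (zlocus_zclosed [set g]).
  + by move=> x /Zfg/vanishes_mul [fx|gx]; [left|right] => _ ->.
  + by left=> x /H; apply.
  + by right=> x /H; apply.
Qed.

Theorem closed_chain_length (X : set (pspace K n)) F e :
  F != 0 -> (forall x, X x -> vanishes_at F x) -> closed_chain X e -> (e < n)%N.
Proof.
move=> F0 FX [Z [Zc Zs]].
(* The chain of affine cones, extended by the origin and by the whole space. *)
pose J i : set {mpoly K[n.+1]} :=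
  if i is j.+1 then if (j <= e)%N then cone_ideal (Z j) else [set 0]
  else [set f | ev f (0 : 'rV[K]_n.+1) = 0].
suff : (e.+2 <= n.+1)%N by [].
apply: (@prime_chain_length _ _ J) => [[|j] je|[|j] je].
- split=> /=.
  + by rewrite meval0.
  + by move=> f g f0 g0; rewrite mevalD f0 g0 addr0.
  + by move=> f g g0; rewrite mevalM g0 mulr0.
  + by rewrite meval1 => /eqP; rewrite oner_eq0.
  + by move=> f g /eqP; rewrite mevalM mulf_eq0 => /orP[]/eqP; [left|right].
- rewrite /J; case: ifP => [je'|_]; first by apply: prime_cone_ideal; case: (Zc _ je').
  split=> //=.
  + by move=> f g -> ->; rewrite addr0.
  + by move=> f g ->; rewrite mulr0.
  + by apply/eqP; rewrite oner_eq0.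
  + by move=> f g /eqP; rewrite mulf_eq0 => /orP[]/eqP; [left|right].
- rewrite /J leq0n; have [_ [[x Zx] _] _] := Zc _ (leq0n e); split.
    by move=> f /(_ x Zx 0); rewrite mem0v; apply.
  have [v v0 xv] := pspace_gen x; have /rV0Pn [i vi] := v0.
  move=> /(_ 'X_i); rewrite /= mevalXU mxE => /(_ erefl x Zx v).
  by rewrite xv memv_line mevalXU => /(_ isT)/eqP; rewrite (negPf vi).
- rewrite /J; have je' : (j <= e)%N by [].
  rewrite je'; case: ifP => [je1|_].
    have [Zsub nsub] := Zs _ je1; split.
      by move=> f fZ x /Zsub; exact: fZ.
    move=> H; apply: nsub => x Zx; have [[E Eh ZE] _ _] := Zc _ je'.
    rewrite ZE => f Ef; apply: (H f) => // y; rewrite ZE; exact.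
  have [_ _ ZX] := Zc _ je'; split.
    by move=> _ -> x _ v _; rewrite meval0.
  by move=> /(_ F) H; move/eqP: F0; apply; apply: H => x /ZX; exact: FX.
Qed.

End ProjectiveDimension.

(** * Hankel determinants and points of secant spaces *)

Section Hankel.
Variable K : fieldType.
Implicit Types (k p : nat) (m t : nat -> K).

(** The Hankel matrix of the moments of [p] nodes [t i] with weights [m i]. *)
Definition hankel_sum k p m t : 'M[K]_k :=
  \matrix_(a, b) \sum_(i < p) m i * t i ^+ (a + b).

Lemma hankel_sumE k p m t :
  let V := Vandermonde k (\row_(i < p) t i) in
  hankel_sum k p m t = V *m diag_mx (\row_i m i) *m V^T.
Proof.
apply/matrixP => a b; rewrite !mxE; apply: eq_bigr => i _.
by rewrite mul_mx_diag !mxE exprD mulrA [m i * _]mulrC.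
Qed.

Lemma det_hankel_sum_eq0 k p m t : (p < k)%N -> \det (hankel_sum k p m t) = 0.
Proof.
move=> pk; apply/eqP; rewrite -[_ == 0]negbK -unitfE -[_ \is a _]/(_ \in unitmx).
rewrite -row_free_unit /row_free hankel_sumE neq_ltn.
rewrite (leq_ltn_trans (mxrankM_maxr _ _)) //.
by rewrite (leq_ltn_trans (rank_leq_row _)).
Qed.

Lemma det_Vandermonde_neq0 k t : {in gtn k &, injective t} ->
  \det (Vandermonde k (\row_(i < k) t i)) != 0.
Proof.
move=> tI; rewrite det_Vandermonde; apply/prodf_neq0 => i _.
apply/prodf_neq0 => j ij; rewrite !mxE subr_eq0; apply/eqP => /tI.
by rewrite !inE !ltn_ord => /(_ isT isT) ji; rewrite ji ltnn in ij.
Qed.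

Lemma det_hankel_sum k m t :
  \det (hankel_sum k k m t) =
  (\prod_(i < k) m i) * \det (Vandermonde k (\row_(i < k) t i)) ^+ 2.
Proof.
rewrite hankel_sumE !det_mulmx det_tr det_diag mulrAC mulrC expr2; congr (_ * _).
by apply: eq_bigr => i _; rewrite mxE.
Qed.

Lemma hankel_sum_narrow k p r m t : (p <= r)%N ->
  (forall i, (p <= i < r)%N -> m i = 0) ->
  hankel_sum k r m t = hankel_sum k p m t.
Proof.
move=> pr m0; apply/matrixP => a b; rewrite !mxE.
rewrite (big_ord_widen r (fun i => m i * t i ^+ (a + b)) pr) [RHS]big_mkcond.
apply: eq_bigr => i _; case: ltnP => // pi.
by rewrite m0 ?mul0r // pi ltn_ord.
Qed.

End Hankel.

Section SecantPoints.

(* The [s i], [t i] are homogeneous coordinates on the projective line. *)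
Definition secpt (R : comNzRingType) n (g : 'M[R]_n.+1) r (m s t : nat -> R) :
    'rV[R]_n.+1 :=
  (\row_k \sum_(i < r) m i * (s i ^+ (n - k) * t i ^+ k)) *m g.

Lemma curve_at_secpt (K : fieldType) n (g : 'M[K]_n.+1) r (m s t : nat -> {poly K}) e :
  curve_at (secpt (map_mx polyC g) r m s t) e =
  secpt g r (fun i => (m i).[e]) (fun i => (s i).[e]) (fun i => (t i).[e]).
Proof.
apply/rowP => j; rewrite !mxE horner_sum; apply: eq_bigr => k _.
rewrite !mxE hornerM hornerC horner_sum; congr (_ * _); apply: eq_bigr => i _.
by rewrite !hornerM !horner_exp.
Qed.

Variables (K : numFieldType) (n : nat) (g : 'M[K]_n.+1).
Hypothesis gU : g \in unitmx.
Implicit Types (m s t l : nat -> K).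

Lemma secptK r m s t k : (secpt g r m s t *m invmx g) 0 k =
  \sum_(i < r) m i * (s i ^+ (n - k) * t i ^+ k).
Proof. by rewrite mulmxK // mxE. Qed.

Lemma eq_secpt r m s t m' s' t' :
  (forall i k, (i < r)%N -> (k <= n)%N ->
     m i * (s i ^+ (n - k) * t i ^+ k) = m' i * (s' i ^+ (n - k) * t' i ^+ k)) ->
  secpt g r m s t = secpt g r m' s' t'.
Proof.
move=> H; congr (_ *m _); apply/rowP => k; rewrite !mxE; apply: eq_bigr => i _.
by apply: H; rewrite // -ltnS.
Qed.

Lemma dhomog_bigprod k (F : 'I_k -> {mpoly K[n.+1]}) :
  (forall i, F i \is 1.-homog) -> \prod_i F i \is k.-homog.
Proof.
elim: k F => [|k IH] F HF; first by rewrite big_ord0 dhomog1.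
by rewrite big_ord_recl; apply: (@dhomogM _ _ _ 1%N); rewrite ?HF // IH.
Qed.

(** A Hankel determinant in the coordinates from index [o] on, in the frame where the curve is the
    standard one. For [k = r.+1] and [o = 0] it vanishes on the secant variety; the other values
    separate the members of the dimension chain. [inord] is faithful as long as
    [o + (k.-1).*2 <= n]. *)
Definition hankel_form k o : {mpoly K[n.+1]} :=
  \det (\matrix_(a < k, b < k) \sum_i invmx g i (inord (o + a + b)) *: 'X_i).

Lemma ev_hankel_form k o (v : 'rV[K]_n.+1) : ev (hankel_form k o) v =
  \det (\matrix_(a < k, b < k) (v *m invmx g) 0 (inord (o + a + b))).
Proof.
rewrite /hankel_form -det_map_mx; congr (\det _); apply/matrixP => a b.
rewrite !mxE raddf_sum; apply: eq_bigr => i _ /=.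
by rewrite mevalZ mevalXU mulrC.
Qed.

Lemma hankel_form_homog k o : homogeneous (hankel_form k o).
Proof.
exists k; apply: rpred_sum => p _; rewrite rpredMsign.
apply: dhomog_bigprod => a; rewrite mxE; apply: rpred_sum => i _.
by rewrite rpredZ // dhomogX /= mdeg1.
Qed.

Lemma ev_hankel_form_secpt k o r l t : (o + (k.-1).*2 <= n)%N ->
  ev (hankel_form k o) (secpt g r l (fun=> 1) t) =
  \det (hankel_sum k r (fun i => l i * t i ^+ o) t).
Proof.
move=> kn; rewrite ev_hankel_form; congr (\det _); apply/matrixP => a b.
rewrite mxE secptK mxE; apply: eq_bigr => i _.
rewrite expr1n mul1r inordK ?exprD ?mulrA // ltnS (leq_trans _ kn) //.
rewrite -addnA leq_add2l -addnn; apply: leq_add.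
  by rewrite -ltnS prednK // (leq_ltn_trans _ (ltn_ord a)).
by rewrite -ltnS prednK // (leq_ltn_trans _ (ltn_ord b)).
Qed.

(** The i-th point of the projective line moves in the direction (1, i). The determinant [D i j]
    that detects a coincidence then has [j - i] as coefficient of ['X^2], nonzero in characteristic
    0. *)
Lemma perturbation r s t : exists2 B : {poly K}, B != 0 &
  forall e, B.[e] != 0 -> (forall i, (i < r)%N -> s i + e != 0) /\
    {in gtn r &, injective (fun i => (t i + i%:R * e) / (s i + e))}.
Proof.
pose S i := (s i)%:P + 'X; pose T i := (t i)%:P + i%:R *: 'X.
pose D i j := S i * T j - S j * T i.
pose B := (\prod_(i < r) S i) * \prod_(i < r) \prod_(j < r | i != j) D i j.
exists B.
  rewrite /B mulf_neq0 //; first by apply/prodf_neq0 => i _; rewrite /S addrC -size_poly_gt0 size_XaddC.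
  apply/prodf_neq0 => i _; apply/prodf_neq0 => j ij; apply/eqP => /(congr1 (fun p : {poly K} => p`_2)).
  rewrite /D /S /T coefB ![(_ + 'X) * _]mulrDl ![_%:P * (_ + _)]mulrDr !['X * (_ + _)]mulrDr.
  rewrite !coefD -!polyCM !coefC -!scalerAr !coefZ !coefCM !coefXM /= !coefC !coefX /=.
  rewrite !mulr0 !add0r !mulr1 => /eqP; rewrite subr_eq0 eqr_nat => /eqP ji.
  by move: ij; rewrite -(inj_eq val_inj) /= ji eqxx.
move=> e; rewrite /B hornerM mulf_eq0 negb_or !horner_prod => /andP[/prodf_neq0 HS /prodf_neq0 HD].
have S0 i : (i < r)%N -> s i + e != 0.
  by move=> ir; have := HS (Ordinal ir) isT; rewrite /S hornerD hornerC hornerX.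
split=> // i j /= ir jr E; apply/eqP/negPn/negP => ij.
have := HD (Ordinal ir) isT; rewrite horner_prod => /prodf_neq0 /(_ (Ordinal jr) ij).
rewrite /D /S /T !hornerE /= => /negP; apply; rewrite subr_eq0 mulrC.
by rewrite [X in _ == X]mulrC -eqr_div ?S0 //; apply/eqP/esym.
Qed.

(** Arbitrary parameters, with repeated nodes, zero weights or nodes at infinity, are the value at 0
    of a polynomial family that is generic elsewhere. Dividing by [s i + e] returns to the affine
    chart and puts its n-th power into the weight. *)
Lemma secpt_density r (f : {mpoly K[n.+1]}) :
  (forall l t, (forall i, (i < r)%N -> l i != 0) -> {in gtn r &, injective t} ->
     ev f (secpt g r l (fun=> 1) t) = 0) ->
  forall m s t, ev f (secpt g r m s t) = 0.
Proof.
move=> H m s t; have [B B0 HB] := perturbation r s t.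
(* With [m] in the role of [s], this makes the weights [m i + e] nonzero. *)
have [B' B'0 HB'] := perturbation r m t.
pose y := secpt (map_mx polyC g) r (fun i => (m i)%:P + 'X) (fun i => (s i)%:P + 'X)
  (fun i => (t i)%:P + i%:R *: 'X).
suff y0 : along f y = 0.
  have := horner_along f y 0; rewrite y0 horner0 curve_at_secpt.
  rewrite (@eq_secpt _ _ _ _ m s t) => [<-//|i k _ _].
  by rewrite !hornerE /= ?mulr0 ?addr0.
apply: (@along_eq0 _ _ _ _ (B * B')); first exact: mulf_neq0.
move=> e; rewrite hornerM mulf_eq0 negb_or => /andP[/HB [s0 tI] /HB' [m0 _]].
rewrite curve_at_secpt.
rewrite (@eq_secpt _ _ _ _ (fun i => (m i + e) * (s i + e) ^+ n) (fun=> 1)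
           (fun i => (t i + i%:R * e) / (s i + e))).
  by apply: H => // i ir; rewrite mulf_neq0 ?m0 // expf_neq0 ?s0.
move=> i k ir kn; rewrite !hornerE /= expr1n mulr1 expr_div_n -!mulrA; congr (_ * _).
rewrite mulrC [RHS]mulrCA; congr (_ * _).
by rewrite -{2}(subnK kn) exprD mulfK // expf_neq0 ?s0.
Qed.

End SecantPoints.

(** * The secant variety and its dimension *)

Section SecantVariety.
Variables (K : numFieldType) (r : nat) (g : 'M[K]_((2 * r).+1)).
Hypotheses (r_gt0 : (0 < r)%N) (gU : g \in unitmx).
Local Notation n := (2 * r)%N.
Implicit Types (m s t l c : nat -> K) (f : {mpoly K[n.+1]}).

Definition curvept (s t : K) : 'rV[K]_n.+1 :=
  (\row_(k < n.+1) (s ^+ (n - k) * t ^+ k)) *m g.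

Lemma secpt_sum p m s t :
  secpt g p m s t = \sum_(i < p) m i *: curvept (s i) (t i).
Proof.
rewrite /curvept /secpt; under eq_bigr do rewrite scalemxAl.
rewrite -mulmx_suml; congr (_ *m _); apply/rowP => k; rewrite !mxE summxE.
by apply: eq_bigr => i _; rewrite !mxE.
Qed.

Lemma scale_secpt p (a : K) m s t : a *: secpt g p m s t = secpt g p (fun i => a * m i) s t.
Proof.
by rewrite !secpt_sum scaler_sumr; apply: eq_bigr => i _; rewrite scalerA.
Qed.

(** At most n + 1 distinct points of a rational normal curve are independent: their first [p]
    coordinates form a Vandermonde matrix. *)
Lemma secpt_eq0 p c t : (p <= n.+1)%N -> {in gtn p &, injective t} ->
  secpt g p c (fun=> 1) t = 0 -> forall i, (i < p)%N -> c i = 0.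
Proof.
move=> pn tI c0 i ip.
pose V := Vandermonde p (\row_(i < p) t i).
have VU : V^T \in unitmx by rewrite unitmx_tr unitmxE unitfE det_Vandermonde_neq0.
have : (\row_(i < p) c i) *m V^T = 0.
  apply/rowP => k; rewrite !mxE.
  have kn := leq_trans (ltn_ord k) pn.
  transitivity ((secpt g p c (fun=> 1) t *m invmx g) 0 (Ordinal kn)); last by rewrite c0 mul0mx mxE.
  by rewrite secptK //; apply: eq_bigr => j _; rewrite !mxE expr1n mul1r.
move/(congr1 (mulmx^~ (invmx V^T))); rewrite mulmxK // mul0mx => /rowP /(_ (Ordinal ip)).
by rewrite !mxE.
Qed.

Lemma curvept_neq0 (a : K) : curvept 1 a != 0.
Proof.
apply/eqP => H; have := @secpt_eq0 1 (fun=> 1) (fun=> a) isT.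
rewrite secpt_sum big_ord1 scale1r H => /(_ _ erefl 0%N isT) /eqP.
by rewrite oner_eq0 => F; suff: false by []; apply: F => -[|//] [|//].
Qed.

Variable C : set (pspace K n).
Hypothesis CE : C = [set x | exists2 u : 'rV[K]_2, u != 0 &
                   val x = <[veronese_curve_vec n u *m g]>%VS].

Let S : set (pspace K n) := [set x | exists p : 'I_r -> pspace K n,
    [/\ forall i, C (p i),
        \dim (\sum_(i < r) val (p i))%VS = r &
        (val x <= \sum_(i < r) val (p i))%VS]].

Let generic l t := (forall i, (i < r)%N -> l i != 0) /\ {in gtn r &, injective t}.

Lemma secant_points x : S x -> exists m s t, val x = <[secpt g r m s t]>%VS.
Proof.
move=> [p [Cp _ xp]]; have [v v0 xv] := pspace_gen x.
have /memv_sumP [vs vsp vE] : v \in (\sum_(i < r) val (p i))%VS.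
  by apply: (subvP xp); rewrite xv memv_line.
have /choice [u uP] i : exists u : K * K * K, vs i = u.1.1 *: curvept u.1.2 u.2.
  have := Cp i; rewrite CE => -[w _ pw].
  have := vsp i isT; rewrite pw => /vlineP [a ->].
  by exists (a, w 0 ord0, w 0 ord_max).
pose h (F : 'I_r -> K) (j : nat) := oapp F 0 (insub j).
have hE F i : h F (val i) = F i by rewrite /h valK.
exists (h (fun i => (u i).1.1)), (h (fun i => (u i).1.2)), (h (fun i => (u i).2)).
rewrite xv vE secpt_sum; congr (<[_]>%VS); apply: eq_bigr => i _.
by rewrite !hE uP.
Qed.

Lemma generic_secant x l t : generic l t ->
  val x = <[secpt g r l (fun=> 1) t]>%VS -> S x.
Proof.
move=> [l0 tI] xv.
exists (fun i : 'I_r => pline (curvept_neq0 (t i))); split.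
- move=> i; rewrite CE; exists (\row_j (if j == ord0 then 1 else t i)).
    by apply/rV0Pn; exists ord0; rewrite mxE /= oner_eq0.
  congr (<[_ *m _]>%VS); apply/rowP => k; rewrite !mxE /=.
  by rewrite !expr1n.
- pose X := [tuple curvept 1 (t i) | i < r].
  have -> : (\sum_(i < r) val (pline (curvept_neq0 (t i))) = <<X>>)%VS.
    by rewrite span_def big_tuple; apply: eq_bigr => i _; rewrite tnth_mktuple.
  suff /eqP -> : free X by rewrite size_tuple.
  apply/freeP => k k0 i.
  pose c (j : nat) := oapp k 0 (insub j).
  have cE j : c (val j) = k j by rewrite /c valK.
  rewrite -cE; apply: (@secpt_eq0 r c t _ tI _ _ (ltn_ord i)).
    by rewrite mul2n -addnn leqW // leq_addr.
  rewrite -[RHS]k0 secpt_sum; apply: eq_bigr => j _.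
  by rewrite cE nth_mktuple.
- rewrite xv -memvE secpt_sum; apply/memv_sumP.
  exists (fun i : 'I_r => l i *: curvept 1 (t i)) => // i _.
  by apply: memvZ; rewrite /= memv_line.
Qed.

(** Turns membership in the ideal into an identity in unrestricted parameters; the passage from
    independent points to all parameters is [secpt_density]. *)
Lemma vanishes_secant f :
  (forall x, S x -> vanishes_at f x) <-> (forall m s t, ev f (secpt g r m s t) = 0).
Proof.
split=> H; last first.
  move=> x /secant_points [m [s [t xE]]] v; rewrite xE => /vlineP [a ->].
  by rewrite scale_secpt.
apply: secpt_density => l t l0 tI.
have v0 : secpt g r l (fun=> 1) t != 0.
  apply/eqP => /secpt_eq0 l0'; have := l0 _ r_gt0; rewrite l0' ?eqxx //.
  by rewrite mul2n -addnn leqW // leq_addr.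
apply: (H (pline v0)); last exact: memv_line.
exact: (@generic_secant _ l t (conj l0 tI)).
Qed.

Local Notation X := (secant_variety r C).

Lemma vanishes_secant_variety f :
  (forall x, X x -> vanishes_at f x) <-> (forall m s t, ev f (secpt g r m s t) = 0).
Proof.
split=> [H|H]; first by apply/vanishes_secant => x Sx; apply: H; apply: subset_zclosure.
by apply: vanishes_zclosure; apply/vanishes_secant.
Qed.

Lemma secpt_secant_variety x m s t : val x = <[secpt g r m s t]>%VS -> X x.
Proof.
move=> xE Z [E Eh ->] SE f Ef; apply/(vanishes_line (Eh _ Ef) xE).
apply: (iffLR (vanishes_secant f)) => y Sy; exact: (SE y Sy f Ef).
Qed.

Lemma hankel_form_secant_variety x : X x -> vanishes_at (hankel_form g r.+1 0) x.
Proof.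
move: x; apply: (iffRL (vanishes_secant_variety _)); apply: secpt_density => // l t _ _.
by rewrite ev_hankel_form_secpt // ?det_hankel_sum_eq0 // add0n mul2n.
Qed.

(** On r + 1 points of weight 1 with nodes 0, ..., r the determinant is the square of a Vandermonde
    determinant. *)
Lemma hankel_form_neq0 : hankel_form g r.+1 0 != 0.
Proof.
apply/eqP => F0; have := @ev_hankel_form_secpt K n g gU r.+1 0 r.+1 (fun=> 1) (fun i => i%:R).
rewrite F0 meval0 add0n /= mul2n leqnn det_hankel_sum => /(_ isT)/esym/eqP.
rewrite mulf_eq0 expf_eq0 /=; apply/negP; rewrite negb_or det_Vandermonde_neq0 ?andbT.
  by apply/prodf_neq0 => i _; rewrite mul1r expr0 oner_eq0.
by move=> i j _ _ /eqP; rewrite eqr_nat => /eqP.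
Qed.

(* The parameters l_0, t_0, l_1, t_1, ... are released one at a time, so the chain alternates
   between the cones over Sec_k C with vertex the point [t = 0] of the curve and Sec_(k+1) C. *)
Definition chain_params (j : nat) l t :=
  (forall i, l i != 0 -> (i.*2 <= j)%N) /\ (forall i, t i != 0 -> (i.*2 < j)%N).

Definition chain_cone (j : nat) : set 'rV[K]_n.+1 :=
  [set v | exists l t, chain_params j l t /\ v = secpt g r l (fun=> 1) t].

Definition chain_set (j : nat) : set (pspace K n) :=
  zclosure [set x | exists2 v, chain_cone j v & val x = <[v]>%VS].

(** The admissible parameters form a linear space, so a segment between two of them gives a
    polynomial curve inside the cone. *)
Lemma chain_set_irreducible j : zirreducible (chain_set j).
Proof.
apply: irreducible_of_curves.
  exists (secpt g r (fun i => (i == 0%N)%:R) (fun=> 1) (fun=> 0)).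
    exists (fun i => (i == 0%N)%:R), (fun=> 0); split=> //; split=> i.
      by case: i => // i; rewrite eqxx.
    by rewrite eqxx.
  apply/eqP => /(congr1 (fun v => (v *m invmx g) 0 ord0)).
  rewrite secptK // mul0mx mxE (bigD1 (Ordinal r_gt0)) //= big1 ?addr0 => [/eqP|i i0].
    by rewrite !mul1r expr1n expr0 mul1r oner_eq0.
  by case: eqP => [i0'|_]; rewrite ?mul0r //; move: i0; rewrite -(inj_eq val_inj) /= i0'.
move=> v w [l [t [[lj tj] ->]]] [l' [t' [[lj' tj'] ->]]].
exists (secpt (map_mx polyC g) r (fun i => (l i)%:P + (l' i - l i) *: 'X) (fun=> 1)
          (fun i => (t i)%:P + (t' i - t i) *: 'X)).
have E (a b e : K) : (a%:P + (b - a) *: 'X).[e] = a + (b - a) * e by rewrite !hornerE.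
split.
- rewrite curve_at_secpt; apply: eq_secpt => i k _ _.
  by rewrite !E !mulr0 !addr0 hornerC.
- rewrite curve_at_secpt; apply: eq_secpt => i k _ _.
  by rewrite !E !mulr1 ![_ + (_ - _)]addrC !subrK hornerC.
- move=> e; rewrite curve_at_secpt.
  exists (fun i => l i + (l' i - l i) * e), (fun i => t i + (t' i - t i) * e); split; last first.
    by apply: eq_secpt => i k _ _; rewrite !E hornerC.
  split=> i; [have [l0 l0'|+ _] := eqVneq (l i) 0|have [t0 t0'|+ _] := eqVneq (t i) 0].
  + by apply: lj'; apply: contraNneq l0' => ->; rewrite l0 subrr mul0r addr0.
  + exact: lj.
  + by apply: tj'; apply: contraNneq t0' => ->; rewrite t0 subrr mul0r addr0.
  + exact: tj.
Qed.

Lemma chain_set_sub j : chain_set j `<=` X.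
Proof.
move=> x; apply; first exact: zclosure_zclosed.
by move=> y [v [l [t [_ ->]]] yE]; apply: (secpt_secant_variety yE).
Qed.

Lemma chain_set_proper_of_form j f : homogeneous f ->
  (forall v, chain_cone j v -> ev f v = 0) ->
  (exists2 v, chain_cone j.+1 v & ev f v != 0) ->
  chain_set j `<` chain_set j.+1.
Proof.
move=> fh fj [v vj fv]; split.
  move=> x; apply; first exact: zclosure_zclosed.
  move=> y [w [l [t [[lj tj] ->]]] yE]; apply: subset_zclosure.
  exists (secpt g r l (fun=> 1) t) => //; exists l, t; split=> //.
  by split=> i /[dup] ? => [/lj|/tj] /leqW.
have fZ x : chain_set j x -> vanishes_at f x.
  by apply: vanishes_zclosure => y [w wj yE]; apply/(vanishes_line fh yE); exact: fj.
have vn : v != 0.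
  apply: contraNneq fv => ->; apply/eqP/fj; exists (fun=> 0), (fun=> 0); split.
    by split=> i; rewrite eqxx.
  by rewrite secpt_sum big1 // => i _; rewrite scale0r.
move=> /(_ (pline vn)) H; move: fv => /negP; apply; apply/eqP.
apply/(vanishes_line (x := pline vn) fh erefl); apply: fZ; apply: H.
by apply: subset_zclosure; exists v.
Qed.

(** The larger set gains a node fixed at 0. Size k + 2 kills sums over k + 1 nodes, but not the sum
    over the distinct nodes k + 1, ..., 1, 0. *)
Lemma chain_set_proper_odd k : (k.+1 < r)%N ->
  chain_set k.*2.+1 `<` chain_set k.*2.+2.
Proof.
move=> kr; apply: (@chain_set_proper_of_form _ (hankel_form g k.+2 0)); first exact: hankel_form_homog.
  move=> _ [l [t [[lj tj] ->]]].
  rewrite ev_hankel_form_secpt //; last by lia.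
  rewrite (@hankel_sum_narrow _ _ k.+1) ?det_hankel_sum_eq0 //; first by lia.
  move=> i /andP[ki _]; rewrite (_ : l i = 0) ?mul0r //.
  by apply/eqP; apply: contraTT ki => /lj; lia.
exists (secpt g r (fun i => (i < k.+2)%:R) (fun=> 1) (fun i => (k.+1 - i)%:R)).
  exists (fun i => (i < k.+2)%:R), (fun i => (k.+1 - i)%:R); split=> //.
  by split=> i; rewrite pnatr_eq0; lia.
rewrite ev_hankel_form_secpt //; last by lia.
rewrite (@hankel_sum_narrow _ _ k.+2) //; last first.
  by move=> i /andP[ki _]; rewrite ltnNge ki mul0r.
rewrite det_hankel_sum; apply: mulf_neq0.
  by apply/prodf_neq0 => i _; rewrite ltn_ord expr0 mulr1 oner_eq0.
apply/expf_neq0/(@det_Vandermonde_neq0 _ _ (fun i => (k.+1 - i)%:R)).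
by move=> i j; rewrite !inE => ik jk /eqP; rewrite eqr_nat; lia.
Qed.

(** On the smaller set node k is stuck at 0. A positive offset [o] multiplies each weight by the
    o-th power of its node, so this node drops out and k nodes face a determinant of size k + 1. The
    offset [2 * (r - k)] is the largest that fits; the witness has the nonzero nodes k + 1, ...,
    1. *)
Lemma chain_set_proper_even k : (k < r)%N -> (k.*2.+1 < 2 * r)%N ->
  chain_set k.*2 `<` chain_set k.*2.+1.
Proof.
move=> kr kr'.
apply: (@chain_set_proper_of_form _ (hankel_form g k.+1 (2 * (r - k)))); first exact: hankel_form_homog.
  move=> _ [l [t [[lj tj] ->]]].
  rewrite ev_hankel_form_secpt //; last by lia.
  rewrite (@hankel_sum_narrow _ _ k) ?det_hankel_sum_eq0 //; first by lia.
  move=> i /andP[ki _]; have [->|/lj ik] := eqVneq (l i) 0; first by rewrite mul0r.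
  rewrite (_ : t i = 0) ?expr0n; first by rewrite (_ : _ == 0%N = false) ?mulr0 //; lia.
  by apply/eqP; apply: contraTT ki => /tj; lia.
exists (secpt g r (fun i => (i < k.+1)%:R) (fun=> 1) (fun i => (k.+1 - i)%:R)).
  exists (fun i => (i < k.+1)%:R), (fun i => (k.+1 - i)%:R); split=> //.
  by split=> i; rewrite pnatr_eq0; lia.
rewrite ev_hankel_form_secpt //; last by lia.
rewrite (@hankel_sum_narrow _ _ k.+1) //; last first.
  by move=> i /andP[ki _]; rewrite ltnNge ki mul0r.
rewrite det_hankel_sum; apply: mulf_neq0.
  apply/prodf_neq0 => i _; rewrite ltn_ord mul1r expf_neq0 // pnatr_eq0.
  by have := ltn_ord i; lia.
apply/expf_neq0/(@det_Vandermonde_neq0 _ _ (fun i => (k.+1 - i)%:R)).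
by move=> i j; rewrite !inE => ik jk /eqP; rewrite eqr_nat; lia.
Qed.

Lemma chain_set_proper j : (j.+1 < 2 * r)%N -> chain_set j `<` chain_set j.+1.
Proof.
rewrite -[j]odd_double_half; case: (odd j) => /= jr; rewrite ?add1n ?add0n.
  by apply: chain_set_proper_odd; lia.
by apply: chain_set_proper_even; lia.
Qed.

Lemma dim_secant_variety : has_dim X (2 * r).-1.
Proof.
split=> [|e eX]; last first.
  by have := closed_chain_length hankel_form_neq0 hankel_form_secant_variety eX; lia.
exists chain_set; split=> [i _|i ir]; last by apply: chain_set_proper; lia.
split; [exact: zclosure_zclosed|exact: chain_set_irreducible|exact: chain_set_sub].
Qed.

End SecantVariety.

(** * Squares of binary forms *)

Section DoubleRoots.
Variable K : fieldType.

Definition node_poly r (t : nat -> K) : {poly K} := \prod_(z <- mkseq t r) ('X - z%:P).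

Lemma size_node_poly r t : size (node_poly r t) = r.+1.
Proof. by rewrite size_prod_XsubC size_mkseq. Qed.

Lemma node_polyE r t : node_poly r t = \prod_(i < r) ('X - (t i)%:P).
Proof.
by rewrite /node_poly big_map -(big_mkord xpredT (fun i => 'X - (t i)%:P)) /index_iota subn0.
Qed.

(** After one division by the node polynomial, the derivative at a simple node shows that the
    quotient vanishes there as well. *)
Lemma node_poly_sqr_dvdp r t (p : {poly K}) : {in gtn r &, injective t} ->
  (forall i, (i < r)%N -> p.[t i] = 0 /\ p^`().[t i] = 0) -> node_poly r t ^+ 2 %| p.
Proof.
move=> tI pt.
have tU : uniq (mkseq t r) by apply/mkseq_uniqP.
have tz z : z \in mkseq t r -> p.[z] = 0 /\ p^`().[z] = 0.
  by move=> /mapP [k]; rewrite mem_iota => kr ->; exact: pt.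
have div q : all (root q) (mkseq t r) -> node_poly r t %| q.
  by move=> qr; apply: uniq_roots_dvdp; rewrite ?uniq_rootsE.
have /dvdpP [q pE] : node_poly r t %| p by apply: div; apply/allP => z /tz [/eqP].
rewrite expr2 pE dvdp_mul2r ?monic_neq0 ?monic_prod_XsubC //; apply: div.
apply/allP => z zt; have [_] := tz z zt.
rewrite pE derivM hornerD !hornerM.
have -> : node_poly r t = ('X - z%:P) * \prod_(y <- rem z (mkseq t r)) ('X - y%:P).
  by rewrite /node_poly (big_rem z).
rewrite derivM derivXsubC mul1r hornerD !hornerM hornerXsubC subrr !mul0r mulr0 add0r addr0.
move/eqP; rewrite mulf_eq0 -[X in _ || X]rootE root_prod_XsubC.
by rewrite (mem_rem_uniq _ tU) !inE eqxx orbF.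
Qed.

Lemma node_poly_sqr_scale r t (p : {poly K}) : (size p <= (2 * r).+1)%N ->
  node_poly r t ^+ 2 %| p -> exists a, p = a *: node_poly r t ^+ 2.
Proof.
move=> ps /dvdpP [q pE].
have Qm : node_poly r t ^+ 2 \is monic by rewrite monic_exp ?monic_prod_XsubC.
have [q0|q0] := eqVneq q 0; first by exists 0; rewrite pE q0 mul0r scale0r.
move: ps; rewrite pE size_Mmonic // expr2 size_Mmonic ?monic_prod_XsubC //; last first.
  by rewrite -size_poly_gt0 size_node_poly.
rewrite size_node_poly => qs; have /size1_polyC -> : (size q <= 1)%N by lia.
by exists q`_0; rewrite mul_polyC.
Qed.

End DoubleRoots.

Section TruncatedSquareRoot.
Variable K : numFieldType.
Implicit Types (A b : {poly K}).

(* Newton iteration for the power series square root of a polynomial with constant term 1. *)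
Fixpoint psqrt A k : {poly K} :=
  if k is j.+1 then
    psqrt A j + ((A - psqrt A j ^+ 2)`_k / 2) *: 'X^k
  else 1.

Lemma size_psqrt A k : (size (psqrt A k) <= k.+1)%N.
Proof.
elim: k => [|k IH] /=; first by rewrite size_poly1.
rewrite (leq_trans (size_polyD _ _)) // geq_max (leq_trans IH) //=.
by rewrite (leq_trans (size_scale_leq _ _)) // size_polyXn.
Qed.

Lemma coef0_psqrt A k : (psqrt A k)`_0 = 1.
Proof.
elim: k => [|k IH] /=; first by rewrite coefC.
by rewrite coefD coefZ coefXn mulr0 addr0.
Qed.

Lemma psqrt_sqr A k j : A`_0 = 1 -> (j <= k)%N -> (psqrt A k ^+ 2)`_j = A`_j.
Proof.
move=> A0; elim: k j => [|k IH] j /=.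
  by rewrite leqn0 => /eqP ->; rewrite expr1n coefC.
set P := psqrt A k; set a := _ / 2; move=> jk.
rewrite sqrrD mulr2n exprZn -exprM -scalerAr !coefD !coefZ coefMXn coefXn.
have [jk'|kj] := ltnP j k.+1.
  rewrite IH // mulr0 !addr0 (_ : (j == _) = false) ?mulr0 ?addr0 //.
  by lia.
have -> : j = k.+1 by apply/eqP; rewrite eqn_leq jk.
rewrite subnn (_ : (k.+1 == _) = false) ?mulr0 ?addr0; last by lia.
by rewrite coef0_psqrt /a coefB mulr1 -splitr addrC subrK.
Qed.

Lemma polyXn_dvdp (p : {poly K}) j : (forall i, (i < j)%N -> p`_i = 0) -> 'X^j %| p.
Proof.
move=> p0; apply/dvdpP; exists (\poly_(i < size p - j) p`_(i + j)).
apply/polyP => i; rewrite coefMXn coef_poly; case: ltnP => [/p0 //|ji].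
rewrite subnK //; case: ltnP => //.
by rewrite leq_subLR subnKC // => pi; apply: nth_default.
Qed.

(* Both square roots agree modulo X^(k+1), because their sum is invertible there. *)
Lemma psqrtE A b k : A = b ^+ 2 -> b`_0 = 1 -> (size b <= k.+1)%N -> psqrt A k = b.
Proof.
move=> Ab b0 bk; have A0 : A`_0 = 1 by rewrite Ab expr2 coef0M b0 mulr1.
apply/eqP; rewrite -subr_eq0; apply/negPn/negP => p0.
have : 'X^(k.+1) %| (psqrt A k - b) * (psqrt A k + b).
  by rewrite -subr_sqr -Ab; apply: polyXn_dvdp => i ik; rewrite coefB psqrt_sqr ?subrr.
rewrite Gauss_dvdpl; last first.
  rewrite coprimep_expl // coprimep_sym -['X]subr0 coprimep_XsubC rootE horner_coef0.
  by rewrite coefD coef0_psqrt b0 -mulr2n pnatr_eq0.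
move=> /(dvdp_leq p0); rewrite size_polyXn ltnNge => /negP; apply.
by rewrite (leq_trans (size_polyD _ _)) // size_polyN geq_max size_psqrt.
Qed.

End TruncatedSquareRoot.

(** * Equations of the cone of squares *)

Section SquareCone.
Variables (K : numClosedFieldType) (r : nat) (g : 'M[K]_((2 * r).+1)).
Hypothesis gU : g \in unitmx.
Local Notation n := (2 * r)%N.
Implicit Types (a b v w : 'rV[K]_n.+1) (c : K).

Definition dot a w := \sum_i a 0 i * w 0 i.

Lemma dot_mulmx a w (h : 'M[K]_n.+1) : dot a (w *m h) = dot (a *m h^T) w.
Proof.
have dotE x y : dot x y = (x *m y^T) 0 0.
  by rewrite mxE; apply: eq_bigr => i _; rewrite mxE.
by rewrite !dotE trmx_mul mulmxA.
Qed.

(* The hyperplane with coefficients [a] pulled back to the curve along [g], as a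
   dehomogenized binary form of degree [2 * r]. *)
Definition form_of a : {poly K} := rVpoly (a *m g^T).

Definition of_form (p : {poly K}) : 'rV[K]_n.+1 := poly_rV p *m invmx g^T.

Lemma trU : g^T \in unitmx. Proof. by rewrite unitmx_tr. Qed.

Lemma form_ofK : cancel form_of of_form.
Proof. by move=> a; rewrite /of_form /form_of rVpolyK mulmxK ?trU. Qed.

Lemma of_formK (p : {poly K}) : (size p <= n.+1)%N -> form_of (of_form p) = p.
Proof. by move=> ps; rewrite /of_form /form_of mulmxKV ?trU // poly_rV_K. Qed.

Lemma form_ofZ c a : form_of (c *: a) = c *: form_of a.
Proof. by rewrite /form_of -scalemxAl linearZ. Qed.

Lemma of_formZ c p : of_form (c *: p) = c *: of_form p.
Proof. by rewrite /of_form linearZ scalemxAl. Qed.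

Lemma size_form_of a : (size (form_of a) <= n.+1)%N.
Proof. exact: size_poly. Qed.

Lemma form_of_eq0 a : (form_of a == 0) = (a == 0).
Proof.
apply/eqP/eqP => [a0|->]; last by rewrite /form_of mul0mx linear0.
by rewrite -[a]form_ofK a0 /of_form linear0 mul0mx.
Qed.

Lemma form_ofE a : form_of a = \sum_(k < n.+1) (a *m g^T) 0 k *: 'X^k.
Proof.
rewrite /form_of /rVpoly poly_def; apply: eq_bigr => k _.
by rewrite valK.
Qed.

Definition scalar_fun (L : {poly K} -> K) :=
  (forall p q, L (p + q) = L p + L q) /\ (forall c p, L (c *: p) = c * L p).

(** A linear functional of the form is a pairing of [a] with a fixed vector: the point of the curve
    for evaluation, its tangent vector for the derivative. *)
Lemma dot_form_of a (L : {poly K} -> K) : scalar_fun L ->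
  L (form_of a) = dot a ((\row_k L 'X^k) *m g).
Proof.
move=> [LD LZ]; have L0 : L 0 = 0 by rewrite -(scale0r 0) LZ mul0r.
rewrite dot_mulmx form_ofE (big_morph L LD L0); apply: eq_bigr => k _.
by rewrite LZ [X in _ = _ * X]mxE.
Qed.

Lemma horner_scalar c : scalar_fun (fun p => p.[c]).
Proof. by split=> [p q|x p]; rewrite ?hornerD ?hornerZ. Qed.

Lemma deriv_scalar c : scalar_fun (fun p => p^`().[c]).
Proof. by split=> [p q|x p]; rewrite ?derivD ?derivZ ?hornerD ?hornerZ. Qed.

Lemma coef_comp_scalar (q : {poly K}) k : scalar_fun (fun p => (p \Po q)`_k).
Proof. by split=> [p p'|x p]; rewrite ?comp_polyD ?comp_polyZ ?coefD ?coefZ. Qed.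

Definition scalar_form (L : {poly K} -> K) : {mpoly K[n.+1]} :=
  \sum_i ((\row_k L 'X^k) *m g) 0 i *: 'X_i.

Lemma ev_scalar_form L a : scalar_fun L -> ev (scalar_form L) a = L (form_of a).
Proof.
move=> /dot_form_of ->; rewrite raddf_sum; apply: eq_bigr => i _ /=.
by rewrite mevalZ mevalXU mulrC.
Qed.

Lemma scalar_form_homog L : scalar_form L \is 1.-homog.
Proof. by apply: rpred_sum => i _; rewrite rpredZ // dhomogX /= mdeg1. Qed.

(* [Y] is a regular function of degree 0 where the form of [a] does not vanish at [c]. *)
Definition regular_off c (Y : 'rV[K]_n.+1 -> K) := exists d (F : {mpoly K[n.+1]}),
  F \is d.-homog /\
  forall a, (form_of a).[c] != 0 -> ev F a = (form_of a).[c] ^+ d * Y a.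

Lemma ev_eval_form c a : ev (scalar_form (fun p => p.[c])) a = (form_of a).[c].
Proof. exact/ev_scalar_form/horner_scalar. Qed.

(** The common denominator: powers of the linear form giving the value at [c] bring several
    fractions to one degree. *)
Lemma regular_off_raise c Y d F e : F \is d.-homog ->
  (forall a, (form_of a).[c] != 0 -> ev F a = (form_of a).[c] ^+ d * Y a) ->
  exists F', F' \is (d + e).-homog /\
    forall a, (form_of a).[c] != 0 -> ev F' a = (form_of a).[c] ^+ (d + e) * Y a.
Proof.
move=> Fd FY; exists (F * scalar_form (fun p => p.[c]) ^+ e); split.
  by rewrite dhomogM // -[e in (e).-homog]mul1n dhomogMn // scalar_form_homog.
by move=> a ac; rewrite mevalM FY // rmorphXn /= ev_eval_form exprD mulrAC.
Qed.

Lemma regular_off_const c (x : K) : regular_off c (fun=> x).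
Proof.
exists 0%N, x%:MP; split; first by rewrite -[x]mulr1 mpolyCM mul_mpolyC rpredZ // mpolyC1 dhomog1.
by move=> a _; rewrite mevalC expr0 mul1r.
Qed.

Lemma regular_offM c Y Y' : regular_off c Y -> regular_off c Y' ->
  regular_off c (fun a => Y a * Y' a).
Proof.
move=> [d [F [Fd FY]]] [d' [F' [Fd' FY']]]; exists (d + d')%N, (F * F').
split; first exact: dhomogM.
by move=> a ac; rewrite mevalM FY // FY' // exprD mulrACA.
Qed.

Lemma regular_offD c Y Y' : regular_off c Y -> regular_off c Y' ->
  regular_off c (fun a => Y a + Y' a).
Proof.
move=> [d [F [Fd FY]]] [d' [F' [Fd' FY']]].
have [G [Gd GY]] := regular_off_raise d' Fd FY.
have [G' [Gd' GY']] := regular_off_raise d Fd' FY'.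
exists (d + d')%N, (G + G'); rewrite addnC in Gd' GY'; split; first by rewrite rpredD.
by move=> a ac; rewrite mevalD GY // GY' // mulrDr.
Qed.

Lemma regular_off_sum c (I : Type) (s : seq I) (P : pred I) (Y : I -> 'rV[K]_n.+1 -> K) :
  (forall i, regular_off c (Y i)) -> regular_off c (fun a => \sum_(i <- s | P i) Y i a).
Proof.
move=> HY; elim: s => [|i s IH].
  have [d [F [Fd FY]]] := regular_off_const c 0.
  by exists d, F; split=> // a ac; rewrite big_nil FY.
have [d [F [Fd FY]]] : regular_off c (fun a => (if P i then Y i a else 0) + \sum_(j <- s | P j) Y j a).
  apply: regular_offD => //; case: (P i) => //; exact: regular_off_const.
exists d, F; split=> // a ac; rewrite FY // big_cons; case: (P i) => //.
by rewrite add0r.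
Qed.

Lemma eq_regular_off c Y Y' : (forall a, (form_of a).[c] != 0 -> Y a = Y' a) ->
  regular_off c Y -> regular_off c Y'.
Proof.
by move=> YY [d [F [Fd FY]]]; exists d, F; split=> // a ac; rewrite FY // YY.
Qed.

Lemma regular_off_common c (I : finType) (Y : I -> 'rV[K]_n.+1 -> K) :
  (forall i, regular_off c (Y i)) -> exists d (F : I -> {mpoly K[n.+1]}),
    (forall i, F i \is d.-homog) /\
    forall i a, (form_of a).[c] != 0 -> ev (F i) a = (form_of a).[c] ^+ d * Y i a.
Proof.
move=> /choice [d /choice [F FY]]; pose D := (\sum_i d i)%N.
have /choice [G GY] i : exists G, G \is D.-homog /\
    forall a, (form_of a).[c] != 0 -> ev G a = (form_of a).[c] ^+ D * Y i a.
  have [Fd Fe] := FY i; have := regular_off_raise (D - d i) Fd Fe.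
  by rewrite subnKC // /D (bigD1 i) //= leq_addr.
by exists D, G; split=> i; case: (GY i).
Qed.

(** The Taylor expansion at [c], scaled to constant term 1 as [psqrt] expects. *)
Definition normal_form c a : {poly K} :=
  (form_of a).[c]^-1 *: (form_of a \Po ('X + c%:P)).

Lemma regular_off_normal c k : regular_off c (fun a => (normal_form c a)`_k).
Proof.
exists 1%N, (scalar_form (fun p => (p \Po ('X + c%:P))`_k)); split; first exact: scalar_form_homog.
move=> a ac; rewrite ev_scalar_form; last exact: coef_comp_scalar.
by rewrite expr1 coefZ mulrA mulfV // mul1r.
Qed.

Lemma regular_off_coefM c (p q : 'rV[K]_n.+1 -> {poly K}) :
  (forall k, regular_off c (fun a => (p a)`_k)) ->
  (forall k, regular_off c (fun a => (q a)`_k)) ->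
  forall k, regular_off c (fun a => (p a * q a)`_k).
Proof.
move=> Hp Hq k.
apply: (@eq_regular_off c (fun a => \sum_(i < k.+1) (p a)`_i * (q a)`_(k - i))).
  by move=> a _; rewrite coefM.
by apply: regular_off_sum => i; apply: regular_offM.
Qed.

Lemma regular_off_psqrt c j k : regular_off c (fun a => (psqrt (normal_form c a) j)`_k).
Proof.
elim: j k => [|j IH] k /=; first exact: regular_off_const.
pose Y a := (psqrt (normal_form c a) j)`_k +
  ((normal_form c a)`_j.+1 + (- 1) * (psqrt (normal_form c a) j * psqrt (normal_form c a) j)`_j.+1)
   * (2^-1 * ('X^(j.+1) : {poly K})`_k).
apply: (@eq_regular_off c Y).
  by move=> a _; rewrite /Y coefD (coefZ (_ / 2)) coefB mulN1r mulrA expr2.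
apply: regular_offD => //; apply: regular_offM; last exact: regular_off_const.
apply: regular_offD; first exact: regular_off_normal.
by apply: regular_offM; [exact: regular_off_const|exact: regular_off_coefM].
Qed.

Definition square_form a := exists2 q : {poly K}, (size q <= r.+1)%N & form_of a = q ^+ 2.

Lemma square_formZ c a : square_form a -> square_form (c *: a).
Proof.
move=> [q qs aq]; exists (sqrtC c *: q); first by rewrite (leq_trans (size_scale_leq _ _)).
by rewrite form_ofZ aq exprZn sqrtCK.
Qed.

Lemma comp_XaddCK c (p : {poly K}) : (p \Po ('X + c%:P)) \Po ('X - c%:P) = p.
Proof. by rewrite -comp_polyA comp_polyD comp_polyX comp_polyC subrK comp_polyXr. Qed.

Lemma psqrt_normal_form c a q : form_of a = q ^+ 2 -> (size q <= r.+1)%N -> q.[c] != 0 ->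
  psqrt (normal_form c a) r = q.[c]^-1 *: (q \Po ('X + c%:P)).
Proof.
move=> aq qs qc; apply: psqrtE.
- by rewrite /normal_form aq horner_exp exprZn exprVn expr2 comp_polyM.
- by rewrite coefZ -horner_coef0 horner_comp !hornerE /= mulVf.
- by rewrite (leq_trans (size_scale_leq _ _)) // size_comp_poly2 // size_XaddC.
Qed.

(** With [psqrt_normal_form], this yields a test for squares: the root truncated at degree r must
    leave no remainder. *)
Lemma square_form_of_psqrt c a : (form_of a).[c] != 0 ->
  psqrt (normal_form c a) r ^+ 2 = normal_form c a -> square_form a.
Proof.
move=> ac aE; exists (sqrtC (form_of a).[c] *: (psqrt (normal_form c a) r \Po ('X - c%:P))).
  rewrite (leq_trans (size_scale_leq _ _)) // size_comp_poly2 ?size_XsubC //.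
  exact: size_psqrt.
rewrite exprZn sqrtCK expr2 -comp_polyM -expr2 aE /normal_form comp_polyZ comp_XaddCK.
by rewrite scalerA mulfV // scale1r.
Qed.

Lemma square_form_closed a :
  (forall P : {mpoly K[n.+1]}, homogeneous P -> (forall b, square_form b -> ev P b = 0) ->
     ev P a = 0) -> square_form a.
Proof.
move=> Ha; have [->|a0] := eqVneq a 0.
  by exists 0; rewrite ?size_poly0 // /form_of mul0mx linear0 expr0n.
have [c ac] : exists c, (form_of a).[c] != 0 by apply: poly_nonroot; rewrite form_of_eq0.
apply: (square_form_of_psqrt ac); apply/polyP => k; apply/eqP; rewrite -subr_eq0; apply/eqP.
have [d [F [Fd FY]]] : regular_off c (fun b =>
    (psqrt (normal_form c b) r ^+ 2)`_k + (-1) * (normal_form c b)`_k).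
  apply: regular_offD; first by apply: regular_off_coefM => j; apply: regular_off_psqrt.
  by apply: regular_offM; [exact: regular_off_const|exact: regular_off_normal].
(* [F] is controlled only where the form does not vanish at [c]; the extra factor makes the product
   vanish on the remaining squares too. *)
have /eqP : ev (F * scalar_form (fun p => p.[c])) a = 0.
  apply: Ha; first by exists (d + 1)%N; apply: dhomogM => //; apply: scalar_form_homog.
  move=> b [q qs bq]; rewrite mevalM ev_eval_form.
  have [->|bc] := eqVneq (form_of b).[c] 0; first by rewrite mulr0.
  rewrite FY // mulN1r -coefB; suff -> : psqrt (normal_form c b) r ^+ 2 = normal_form c b.
    by rewrite subrr coef0 mulr0 mul0r.
  have qc : q.[c] != 0 by move: bc; rewrite bq horner_exp expf_eq0.
  rewrite (psqrt_normal_form bq) // /normal_form bq horner_exp exprZn exprVn.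
  by rewrite expr2 comp_polyM.
rewrite mevalM ev_eval_form mulf_eq0 (negPf ac) orbF FY // mulf_eq0 expf_eq0 (negPf ac) andbF /=.
by rewrite mulN1r => /eqP.
Qed.

End SquareCone.

(** * Tangent hyperplanes *)

Section Gradients.
Variables (K : numClosedFieldType) (r : nat) (g : 'M[K]_((2 * r).+1)).
Hypotheses (r_gt0 : (0 < r)%N) (gU : g \in unitmx).
Local Notation n := (2 * r)%N.
Implicit Types (m s t l : nat -> K) (f : {mpoly K[n.+1]}) (a b v w y : 'rV[K]_n.+1).

Definition grad f v : 'rV[K]_n.+1 := \row_i ev f^`M(i) v.

Lemma dot_grad f v w : dot (grad f v) w = \sum_i ev f^`M(i) v * w 0 i.
Proof. by apply: eq_bigr => i _; rewrite mxE. Qed.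

Lemma dot_grad_curve f (c : 'rV[{poly K}]_n.+1) e :
  dot (grad f (curve_at c e)) (curve_at (map_mx (@deriv K) c) e) = (along f c)^`().[e].
Proof. by rewrite dot_grad horner_deriv_along. Qed.

Lemma dotDr a v w : dot a (v + w) = dot a v + dot a w.
Proof. by rewrite /dot -big_split; apply: eq_bigr => i _; rewrite mxE mulrDr. Qed.

Lemma dotZr a c w : dot a (c *: w) = c * dot a w.
Proof. by rewrite /dot mulr_sumr; apply: eq_bigr => i _; rewrite mxE mulrCA. Qed.

Lemma dotZl a c w : dot (c *: a) w = c * dot a w.
Proof. by rewrite /dot mulr_sumr; apply: eq_bigr => i _; rewrite mxE mulrA. Qed.

Lemma dot_delta a i : dot a (delta_mx 0 i) = a 0 i.
Proof.
rewrite /dot (bigD1 i) //= mxE !eqxx mulr1 big1 ?addr0 // => j ji.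
by rewrite mxE eqxx (negPf ji) mulr0.
Qed.

Lemma curvept_dot a (t : K) : dot a (curvept g 1 t) = (form_of g a).[t].
Proof.
rewrite (dot_form_of _ _ (horner_scalar t)); congr (dot a (_ *m g)).
by apply/rowP => k; rewrite !mxE expr1n mul1r hornerXn.
Qed.

Lemma secpt_add_point p l t e (z : K) :
  secpt g p.+1 (fun j => if (j < p)%N then l j else e) (fun=> 1)
               (fun j => if (j < p)%N then t j else z) =
  secpt g p l (fun=> 1) t + e *: curvept g 1 z.
Proof.
rewrite !secpt_sum big_ord_recr /= ltnn; congr (_ + _).
by apply: eq_bigr => i _; rewrite ltn_ord.
Qed.

Lemma secpt_scale_point l t e (i : 'I_r) :
  secpt g r (fun j => if j == i then l j + e else l j) (fun=> 1) t =
  secpt g r l (fun=> 1) t + e *: curvept g 1 (t i).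
Proof.
rewrite !secpt_sum (bigD1 i) //= eqxx [in RHS](bigD1 i) //= scalerDl addrAC.
congr (_ + _ + _); apply: eq_bigr => j ji.
by rewrite (_ : (j == i :> nat) = false) //; apply/negbTE.
Qed.

Lemma secpt_move_point l t (z : K) (i : 'I_r) :
  secpt g r l (fun=> 1) (fun j => if j == i then z else t j) =
  secpt g r l (fun=> 1) t + l i *: (curvept g 1 z - curvept g 1 (t i)).
Proof.
rewrite !secpt_sum (bigD1 i) //= eqxx [in RHS](bigD1 i) //= scalerBr.
rewrite addrAC [_ + (_ - _)]addrC subrK; congr (_ + _); apply: eq_bigr => j ji.
by rewrite (_ : (j == i :> nat) = false) //; apply/negbTE.
Qed.

Definition line_curve v w : 'rV[{poly K}]_n.+1 := \row_j ((v 0 j)%:P + w 0 j *: 'X).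

Lemma line_curve_at v w e : curve_at (line_curve v w) e = v + e *: w.
Proof. by apply/rowP => j; rewrite !mxE !hornerE mulrC. Qed.

Lemma line_curve_deriv v w e : curve_at (map_mx (@deriv K) (line_curve v w)) e = w.
Proof. by apply/rowP => j; rewrite !mxE derivD derivC derivZ derivX !hornerE. Qed.

Definition moving_curve v (c z : K) : 'rV[{poly K}]_n.+1 :=
  \row_j ((v 0 j)%:P + c *: \sum_(k < n.+1) g k j *: ('X + z%:P) ^+ k).

Lemma moving_curve_at v c z e :
  curve_at (moving_curve v c z) e = v + c *: curvept g 1 (e + z).
Proof.
apply/rowP => j; rewrite !mxE hornerD hornerC hornerZ horner_sum; congr (_ + _ * _).
apply: eq_bigr => k _.
by rewrite !mxE !hornerE /= ?horner_exp ?hornerE expr1n ?mul1r ?mulr1 mulrC.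
Qed.

Lemma moving_curve_deriv a v c z :
  dot a (curve_at (map_mx (@deriv K) (moving_curve v c z)) 0) = c * (form_of g a)^`().[z].
Proof.
rewrite (dot_form_of _ _ (deriv_scalar z)) -dotZr; congr (dot a _).
apply/rowP => j; rewrite !mxE derivD derivC derivZ raddf_sum add0r hornerZ horner_sum.
congr (_ * _); apply: eq_bigr => k _; rewrite !mxE /= derivZ deriv_exp derivXn.
by rewrite !hornerE derivD derivX derivC addr0 mul1r !hornerMn !hornerE mulrC.
Qed.

Lemma grad_form f l t :
  (forall m s t, ev f (secpt g r m s t) = 0) ->
  (forall i, (i < r)%N -> l i != 0) -> {in gtn r &, injective t} ->
  exists c, form_of g (grad f (secpt g r l (fun=> 1) t)) = c *: node_poly r t ^+ 2.
Proof.
move=> fX l0 tI; set y := secpt g r l _ t.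
have curve0 c : (forall e, exists m s t, curve_at c e = secpt g r m s t) -> along f c = 0.
  move=> cE; apply: (@along_eq0 _ _ _ _ 1); first exact: oner_neq0.
  by move=> e _; have [m [s [t' ->]]] := cE e; exact: fX.
apply: node_poly_sqr_scale; first exact: size_form_of.
apply: node_poly_sqr_dvdp => // i ir; pose i' := Ordinal ir; split.
- have c0 : along f (line_curve y (curvept g 1 (t i))) = 0.
    by apply: curve0 => e; rewrite line_curve_at -(secpt_scale_point _ _ _ i'); eexists _, _, _.
  have := dot_grad_curve f (line_curve y (curvept g 1 (t i))) 0.
  by rewrite c0 deriv0 horner0 line_curve_deriv line_curve_at scale0r addr0 curvept_dot.
(* The i-th summand is removed and put back with its node displaced: at 0 the curve passes through
   [y], with velocity [l i] times the tangent vector at [t i]. *)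
- pose c := moving_curve (y - l i *: curvept g 1 (t i)) (l i) (t i).
  have cE e : curve_at c e = y + l i *: (curvept g 1 (e + t i) - curvept g 1 (t i)).
    by rewrite moving_curve_at scalerBr addrAC addrA.
  have c0 : along f c = 0.
    by apply: curve0 => e; rewrite cE -(secpt_move_point _ _ _ i'); eexists _, _, _.
  have := dot_grad_curve f c 0.
  rewrite c0 deriv0 horner0 cE add0r subrr scaler0 addr0 moving_curve_deriv.
  by move/eqP; rewrite mulf_eq0 (negPf (l0 _ ir)) => /eqP.
Qed.

Lemma square_form_node c t a : form_of g a = c *: node_poly r t ^+ 2 -> square_form g a.
Proof.
move=> aE; exists (sqrtC c *: node_poly r t).
  by rewrite (leq_trans (size_scale_leq _ _)) // size_node_poly.
by rewrite aE exprZn sqrtCK.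
Qed.

Definition comp_grad (P : {mpoly K[n.+1]}) f := P \mPo [tuple f^`M(i) | i < n.+1].

Lemma ev_comp_grad P f v : ev (comp_grad P f) v = ev P (grad f v).
Proof.
rewrite comp_mpoly_meval; apply: meval_eq => i.
by rewrite tnth_mktuple mxE.
Qed.

(** The gradient is known to be a square only at generic parameters. Its composite with [P] is a
    polynomial on the ambient space, so density extends the equation to all parameters. *)
Lemma comp_grad_secpt P f : (forall m s t, ev f (secpt g r m s t) = 0) ->
  (forall b, square_form g b -> ev P b = 0) ->
  forall m s t, ev (comp_grad P f) (secpt g r m s t) = 0.
Proof.
move=> fX P0; apply: secpt_density => l t l0 tI; rewrite ev_comp_grad; apply: P0.
by have [c /square_form_node] := grad_form fX l0 tI.
Qed.

Lemma hankel_form_vanish m s t : ev (hankel_form g r.+1 0) (secpt g r m s t) = 0.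
Proof.
move: m s t; apply: secpt_density => l t _ _.
by rewrite ev_hankel_form_secpt // ?det_hankel_sum_eq0 // add0n mul2n.
Qed.

(** Moving from the point towards a further point of the curve, with a new node [z], makes the
    determinant equal to [k * e], where [k] is the product of the weights and a squared Vandermonde
    determinant. Its derivative [k] is nonzero. *)
Lemma grad_hankel_form_neq0 l t :
  (forall i, (i < r)%N -> l i != 0) -> {in gtn r &, injective t} ->
  grad (hankel_form g r.+1 0) (secpt g r l (fun=> 1) t) != 0.
Proof.
move=> l0 tI; set f := hankel_form _ _ _; set y := secpt g r l _ t.
have [z zt] := @poly_nonroot _ (node_poly r t) (monic_neq0 (monic_prod_XsubC _ _ _)).
pose t' j := if (j < r)%N then t j else z.
have zt' j : (j < r)%N -> t j != z.
  move=> jr; apply: contraNneq zt => <-; rewrite -rootE root_prod_XsubC.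
  by rewrite /mkseq map_f // mem_iota.
have t'I : {in gtn r.+1 &, injective t'}.
  move=> i j; rewrite !inE !ltnS /t' => ir jr.
  case: ltnP => ir'; case: ltnP => jr'.
  - exact: tI.
  - by move=> E; move: (zt' _ ir'); rewrite E eqxx.
  - by move=> E; move: (zt' _ jr'); rewrite E eqxx.
  - by move=> _; apply/eqP; rewrite eqn_leq !(leq_trans _ ir', leq_trans _ jr').
pose D := \det (Vandermonde r.+1 (\row_(i < r.+1) t' i)).
pose k := (\prod_(i < r) l i) * D ^+ 2.
have k0 : k != 0.
  apply: mulf_neq0; first by apply/prodf_neq0 => i _; apply: l0.
  exact/expf_neq0/det_Vandermonde_neq0.
pose c := line_curve y (curvept g 1 z).
have cE : along f c = k *: 'X.
  apply/eqP; rewrite -subr_eq0; apply/negPn/negP => /poly_nonroot [e].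
  rewrite hornerD hornerN hornerZ hornerX horner_along line_curve_at -secpt_add_point.
  rewrite ev_hankel_form_secpt // ?add0n ?mul2n // det_hankel_sum big_ord_recr /=.
  rewrite ltnn !expr0 !mulr1 (eq_bigr (fun i : 'I_r => l i)) => [|i _]; last by rewrite ltn_ord expr0 mulr1.
  by rewrite -/t' -/D /k mulrAC subrr eqxx.
apply: contraNneq k0 => gr0.
have := dot_grad_curve f c 0.
rewrite cE derivZ derivX hornerZ hornerC mulr1 line_curve_at scale0r addr0 gr0 => <-.
by rewrite /dot big1 // => i _; rewrite mxE mul0r.
Qed.

End Gradients.

(** * Hyperplanes and their annihilators *)

Section LinearAlgebra.
Variables (K : numClosedFieldType) (r : nat).
Local Notation n := (2 * r)%N.
Implicit Types (a b v w : 'rV[K]_n.+1).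

Definition dot_kernel a : {vspace 'rV[K]_n.+1} := lker (linfun (mulmxr a^T)).

Lemma mem_dot_kernel a w : (w \in dot_kernel a) = (dot a w == 0).
Proof.
rewrite memv_ker lfunE /= [w *m _]mx11_scalar -scalemx1 scaler_eq0 oner_eq0 orbF.
by congr (_ == 0); rewrite mxE /dot; apply: eq_bigr => i _; rewrite mxE mulrC.
Qed.

Lemma dim_dot_kernel a : a != 0 -> \dim (dot_kernel a) = n.
Proof.
move=> a0; have := limg_ker_dim (linfun (mulmxr a^T) : 'Hom('rV[K]_n.+1, 'rV[K]_1)) fullv.
rewrite capfv dimvf /dim /= mul1n -/(dot_kernel a) => E.
have : (\dim (limg (linfun (mulmxr a^T) : 'Hom('rV[K]_n.+1, 'rV[K]_1))) <= 1)%N.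
  by rewrite (leq_trans (dimvS (subvf _))) // dimvf /dim /= mul1n.
have : (\dim (dot_kernel a) < n.+1)%N.
  rewrite ltn_neqAle andbC; apply/andP; split; first by rewrite -[X in (_ <= X)%N]E leq_addr.
  apply: contraNneq a0 => dE; apply/eqP/rowP => i.
  have /eqP F : dot_kernel a == fullv.
    by rewrite eqEdim subvf dE dimvf /dim /= mul1n.
  have : delta_mx 0 i \in dot_kernel a by rewrite F memvf.
  by rewrite mem_dot_kernel dot_delta mxE => /eqP.
have aux (k i N : nat) : (k + i = N.+1 -> k < N.+1 -> i <= 1 -> k = N)%N by lia.
exact: aux E.
Qed.

Lemma annihilator_line (T : {vspace 'rV[K]_n.+1}) a b : (n <= \dim T)%N -> b != 0 ->
  (forall w, w \in T -> dot a w = 0) -> (forall w, w \in T -> dot b w = 0) ->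
  exists c, a = c *: b.
Proof.
move=> nT b0 aT bT.
have TE : T = dot_kernel b.
  apply/eqP; rewrite eqEdim dim_dot_kernel // nT andbT.
  by apply/subvP => w /bT; rewrite mem_dot_kernel => ->.
have /rV0Pn [i bi] := b0.
exists (a 0 i / b 0 i); apply/rowP => j; rewrite mxE.
have : dot a (delta_mx 0 j + (- (b 0 j / b 0 i)) *: delta_mx 0 i) = 0.
  apply: aT; rewrite TE mem_dot_kernel dotDr dotZr !dot_delta mulNr divfK // subrr //.
rewrite dotDr dotZr !dot_delta mulNr => /eqP; rewrite subr_eq0 => /eqP ->.
by rewrite mulrC mulrA mulrAC.
Qed.

End LinearAlgebra.

(** * The dual of the secant variety as the set of squares *)

Section DualVariety.
Variables (K : numClosedFieldType) (r : nat) (g : 'M[K]_((2 * r).+1)).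
Hypotheses (r_gt0 : (0 < r)%N) (gU : g \in unitmx).
Local Notation n := (2 * r)%N.
Variable C : set (pspace K n).
Hypothesis CE : C = [set x | exists2 u : 'rV[K]_2, u != 0 &
                   val x = <[veronese_curve_vec n u *m g]>%VS].
Local Notation X := (secant_variety r C).
Implicit Types (m s t l : nat -> K) (f : {mpoly K[n.+1]}) (a b v w y : 'rV[K]_n.+1).

Let vanX f := vanishes_secant_variety r_gt0 gU CE f.

(* The orthogonal of the tangent space is the line of a gradient, which satisfies the equations
   of the squares because gradients at generic points do. *)
Lemma tangent_square x h : nonsingular_at X x -> tangent_hyperplane X x h ->
  forall a, a \in val h -> square_form g a.
Proof.
move=> [Xx [T [d [TE Xd dT]]]] Th a ah.
have [X1 X2] := dim_secant_variety r_gt0 gU CE.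
have nT : (n <= \dim T)%N by have := Xd.2 _ X1; rewrite dT; lia.
have [f [v [fX vx gf fT]]] : exists f v,
    [/\ forall z, X z -> vanishes_at f z, v \in val x,
        grad f v != 0 & forall w, w \in T -> dot (grad f v) w = 0].
  (* If all these gradients vanished, every vector would be tangent and the dimension would be 2r
     instead of 2r - 1. *)
  apply: contrapT => H; have : T = fullv.
    apply/eqP; rewrite eqEsubv subvf; apply/subvP => w _; apply/TE => f fh fX v vx.
    rewrite -dot_grad; have [->|gf] := eqVneq (grad f v) 0.
      by rewrite /dot big1 // => i _; rewrite mxE mul0r.
    exfalso; apply: H; exists f, v; split=> // w' /TE /(_ f fh fX v vx).
    by rewrite -dot_grad.
  move=> TF; move: dT; rewrite TF dimvf /dim /= mul1n => -[dE].
  by have := X2 _ Xd.1; rewrite -dE; lia.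
have [c ->] := annihilator_line nT gf (fun w wT => Th a w ah (iffLR (TE w) wT)) fT.
apply: square_formZ; apply: square_form_closed => // P _ P0.
rewrite -ev_comp_grad.
suff H m s t : ev (comp_grad P f) (secpt g r m s t) = 0 by exact: (iffRL (vanX _) H x Xx v vx).
by apply: comp_grad_secpt => //; apply/vanX.
Qed.

(** All gradients at [y] are multiples of [a] and the one of the Hankel determinant is nonzero, so
    the tangent space is exactly the orthogonal of [a], of dimension 2r. *)
Lemma generic_tangent l t (h : pspace K n) :
  (forall i, (i < r)%N -> l i != 0) -> {in gtn r &, injective t} ->
  val h = <[of_form g (node_poly r t ^+ 2)]>%VS ->
  exists2 x, nonsingular_at X x & tangent_hyperplane X x h.
Proof.
move=> l0 tI hE; set a := of_form g _ in hE.
set y := secpt g r l (fun=> 1) t.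
have sN : (size (node_poly r t ^+ 2) <= n.+1)%N.
  rewrite expr2 (leq_trans (size_polyMleq _ _)) // size_node_poly; lia.
have aE : form_of g a = node_poly r t ^+ 2 by rewrite of_formK.
have a0 : a != 0 := val_line_neq0 hE.
have F0 := grad_hankel_form_neq0 gU l0 tI.
have FX := hankel_form_vanish gU.
have grad_line f : (forall m s t, ev f (secpt g r m s t) = 0) ->
    exists c, grad f y = c *: a.
  move=> fX; have [c cE] := grad_form fX l0 tI.
  by exists c; rewrite /a -of_formZ -cE form_ofK.
have yn : y != 0.
  apply/eqP => /(secpt_eq0 gU) l00; have := l0 _ r_gt0; rewrite l00 ?eqxx //.
  by rewrite mul2n -addnn leqW // leq_addr.
pose x := pline yn.
have Xx : X x by apply: (secpt_secant_variety r_gt0 gU CE (m := l) (s := fun=> 1) (t := t)).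
have tanE w : tangent_vectors X x w <-> dot a w = 0.
  split=> [wT|aw f [d fd] fX v].
    have [c cE] := grad_line _ FX; move: F0; rewrite -/y cE scaler_eq0 negb_or => /andP[c0 _].
    have := wT _ (hankel_form_homog g r.+1 0) (iffRL (vanX _) FX) y (memv_line y).
    rewrite -dot_grad cE dotZl => /eqP.
    by rewrite mulf_eq0 (negPf c0) => /eqP.
  rewrite /x /= => /vlineP [k ->]; rewrite -dot_grad.
  have fX' := iffLR (vanX f) fX.
  (* [tangent_vectors] tests all multiples of [y]. Nonzero ones are again generic, with weights
     [e * l i]; the zero multiple follows because a polynomial in the scalar is at stake. *)
  suff H : along (\sum_i w 0 i *: f^`M(i)) (line_curve 0 y) = 0.
    have := horner_along (\sum_i w 0 i *: f^`M(i)) (line_curve 0 y) k.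
    rewrite H horner0 line_curve_at add0r raddf_sum /= => E.
    rewrite dot_grad [RHS]E; apply: eq_bigr => i _.
    by rewrite mevalZ mulrC.
  apply: (@along_eq0 _ _ _ _ 'X); first by rewrite -size_poly_gt0 size_polyX.
  move=> e; rewrite hornerX => e0; rewrite line_curve_at add0r raddf_sum /=.
  have l0' i : (i < r)%N -> e * l i != 0 by move=> ir; rewrite mulf_neq0 ?l0.
  have [c cE] := grad_form fX' l0' tI.
  transitivity (dot (grad f (e *: y)) w).
    by rewrite dot_grad; apply: eq_bigr => i _; rewrite mevalZ mulrC.
  have -> : grad f (e *: y) = c *: a by rewrite /a -of_formZ -cE form_ofK // /y scale_secpt.
  by rewrite dotZl aw mulr0.
exists x.
  split=> //; exists (dot_kernel a), (2 * r).-1; split.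
  - by move=> w; rewrite mem_dot_kernel; split=> [/eqP|] /tanE => [|->].
  - exact: (dim_secant_variety r_gt0 gU CE).
  - by rewrite dim_dot_kernel //; lia.
move=> b w; rewrite hE => /vlineP [c ->] /tanE aw.
by rewrite -[LHS]/(dot (c *: a) w) dotZl aw mulr0.
Qed.

Lemma split_forms (q : {poly K}) : (size q <= r.+1)%N -> exists c (s t : nat -> K),
  q = c *: \prod_(i < r) (s i *: 'X - (t i)%:P).
Proof.
move=> qs; have [->|q0] := eqVneq q 0.
  by exists 0, (fun=> 0), (fun=> 0); rewrite scale0r.
have [rs qE] := closed_field_poly_normal q.
have rsr : (size rs <= r)%N.
  by move: qs; rewrite qE size_scale ?lead_coef_eq0 // size_prod_XsubC.
(* Missing roots are placed at infinity: the pair (0, -1) contributes the factor 1. *)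
exists (lead_coef q), (fun i => (i < size rs)%:R),
  (fun i => if (i < size rs)%N then rs`_i else -1).
rewrite {1}qE; congr (_ *: _); rewrite (big_nth 0) big_mkord.
rewrite (big_ord_widen r (fun i => 'X - (rs`_i)%:P) rsr) big_mkcond.
apply: eq_bigr => i _; case: ifP => _; first by rewrite scale1r.
by rewrite scale0r sub0r polyCN opprK.
Qed.

(* Linear factors in general position approximate arbitrary ones. *)
Lemma square_form_dual (h : pspace K n) a :
  val h = <[a]>%VS -> square_form g a -> dual_variety X h.
Proof.
move=> hE [q qs aq].
have a0 : a != 0 := val_line_neq0 hE.
have [c [s [t qE]]] := split_forms qs.
move=> Z [E Eh ->] SE f Ef; apply/(vanishes_line (Eh _ Ef) hE).
(* The outer variable is that of the binary form, the inner one the deformation parameter; at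
   parameter 0 this is [q] up to [c]. *)
pose G : {poly {poly K}} :=
  \prod_(i < r) (((s i)%:P + 'X) *: 'X - ((t i)%:P + i%:R *: 'X)%:P).
pose gam : 'rV[{poly K}]_n.+1 := (\row_k (G ^+ 2)`_k) *m map_mx polyC (invmx g^T).
pose Q e := \prod_(i < r) ((s i + e) *: 'X - (t i + i%:R * e)%:P).
have GE e : map_poly (horner_eval e) G = Q e.
  rewrite /G rmorph_prod; apply: eq_bigr => i _.
  rewrite rmorphB /= map_polyZ map_polyX map_polyC /= !horner_evalE.
  by rewrite !hornerE.
have gamE e : curve_at gam e = of_form g (Q e ^+ 2).
  apply/rowP => j; rewrite !mxE horner_sum; apply: eq_bigr => k _.
  rewrite !mxE hornerM hornerC; congr (_ * _).
  by rewrite -GE -rmorphXn /= coef_map.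
have [B B0 HB] := perturbation r s t.
have : along f gam = 0.
  apply: (along_eq0 B0) => e /HB [s0 tI].
  pose t' i := (t i + i%:R * e) / (s i + e).
  have QE : Q e = (\prod_(i < r) (s i + e)) *: node_poly r t'.
    rewrite /Q node_polyE -scaler_prod.
    apply: eq_bigr => i _; rewrite scalerBr; congr (_ - _).
    by rewrite -mul_polyC -polyCM /t' [(s i + e) * _]mulrC divfK ?s0.
  rewrite gamE QE exprZn of_formZ; set w := of_form g _.
  have [d fd] := Eh _ Ef; rewrite (dhomog_scale _ _ fd).
  have sN : (size (node_poly r t' ^+ 2) <= n.+1)%N.
    rewrite expr2 (leq_trans (size_polyMleq _ _)) // size_node_poly; lia.
  have w0 : w != 0.
    rewrite -(form_of_eq0 gU) of_formK // expf_eq0 /= -size_poly_eq0 size_node_poly //.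
  suff -> : ev f w = 0 by rewrite mulr0.
  apply/(vanishes_line (x := pline w0) (Eh _ Ef) erefl); apply: SE => //.
  by apply: (@generic_tangent (fun=> 1) t') => // i _; rewrite oner_eq0.
move/(congr1 (horner^~ 0)); rewrite horner_along gamE horner0 => Q0.
have -> : a = c ^+ 2 *: of_form g (Q 0 ^+ 2).
  rewrite -of_formZ -exprZn; suff <- : q = c *: Q 0 by rewrite -aq form_ofK.
  rewrite qE; congr (_ *: _); apply: eq_bigr => i _.
  by rewrite mulr0 !addr0.
by have [d fd] := Eh _ Ef; rewrite (dhomog_scale _ _ fd) Q0 mulr0.
Qed.

Theorem dual_secant_variety (h : pspace K n) a : val h = <[a]>%VS ->
  dual_variety X h <-> square_form g a.
Proof.
move=> hE; split=> [hX|]; last exact: square_form_dual.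
apply: square_form_closed => // P Ph P0; apply/(vanishes_line Ph hE).
apply: (vanishes_zclosure _ hX) => k [x xX kX] v vk; apply: P0.
exact: tangent_square xX kX v vk.
Qed.

End DualVariety.

(** * The projection and its inverse *)

Section VeroneseProjection.
Variables (K : numClosedFieldType) (r : nat) (g : 'M[K]_((2 * r).+1)).
Hypotheses (r_gt0 : (0 < r)%N) (gU : g \in unitmx).
Local Notation n := (2 * r)%N.
Local Notation N := (quad_dim r).
Implicit Types (u : 'rV[K]_r.+1) (a v : 'rV[K]_n.+1).

Definition quad_pair (p : 'I_N.+1) : 'I_r.+1 * 'I_r.+1 := nth (ord0, ord0) (quad_pairs r) p.

Lemma sum_quad_pair (F : 'I_r.+1 * 'I_r.+1 -> K) :
  \sum_p F (quad_pair p) = \sum_(x : 'I_r.+1 * 'I_r.+1 | (x.1 <= x.2)%N) F x.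
Proof.
rewrite -(big_mkord xpredT (fun k => F (nth (ord0, ord0) (quad_pairs r) k))).
by rewrite -size_quad_pairs -(big_nth _ xpredT) big_filter big_enum_cond.
Qed.

(* The matrix of multiplication of linear forms in the monomials [X_i X_j], [i <= j]. *)
Definition square_mx : 'M[K]_(N.+1, n.+1) :=
  \matrix_(p, k) let x := quad_pair p in
    (x.1 + x.2 == k)%N%:R * (1 + (x.1 < x.2)%N%:R).

Lemma veronese_square_mx u :
  quad_veronese_vec u *m square_mx = poly_rV (rVpoly u ^+ 2).
Proof.
apply/rowP => k; rewrite !mxE.
pose F (x : 'I_r.+1 * 'I_r.+1) := u 0 x.1 * u 0 x.2 * (x.1 + x.2 == k)%N%:R.
have -> : (rVpoly u ^+ 2)`_k = \sum_x F x.
  rewrite /rVpoly poly_def expr2 big_distrlr /= pair_bigA coef_sum.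
  apply: eq_bigr => -[i j] _ /=.
  by rewrite !valK -scalerAl -scalerAr scalerA -exprD coefZ coefXn eq_sym.
pose G (x : 'I_r.+1 * 'I_r.+1) := F x * (1 + (x.1 < x.2)%N%:R).
transitivity (\sum_p G (quad_pair p)).
  by apply: eq_bigr => p _; rewrite !mxE /G /F mulrA.
rewrite sum_quad_pair [RHS](bigID (fun x : 'I_r.+1 * 'I_r.+1 => (x.1 <= x.2)%N)) /=.
rewrite /G; under eq_bigr do rewrite mulrDr mulr1.
rewrite big_split /=; congr (_ + _).
rewrite (reindex_inj (h := fun x : 'I_r.+1 * 'I_r.+1 => (x.2, x.1))) /=; last by move=> [a b] [c d] [-> ->].
rewrite big_mkcond [RHS]big_mkcond; apply: eq_bigr => -[i j] _ /=.
rewrite /F /= -ltnNge; case: ltngtP => // _; rewrite ?mulr1 ?mulr0 //.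
by rewrite [u 0 j * _]mulrC addnC.
Qed.

(** Each row has a single nonzero entry, 1 or 2, and every k up to 2r is reached as
    [k./2 + uphalf k] with both halves at most r. *)
Lemma square_mx_full : row_full square_mx.
Proof.
have /choice [idx idxP] (k : 'I_n.+1) : exists p : 'I_N.+1, ((quad_pair p).1 + (quad_pair p).2 = k)%N.
  have ir : (k./2 < r.+1)%N by have := ltn_ord k; lia.
  have jr : (uphalf k < r.+1)%N by have := ltn_ord k; lia.
  have xq : (Ordinal ir, Ordinal jr) \in quad_pairs r.
    by rewrite mem_filter mem_enum andbT /=; lia.
  have pN : (index (Ordinal ir, Ordinal jr) (quad_pairs r) < N.+1)%N.
    by rewrite -size_quad_pairs index_mem.
  by exists (Ordinal pN); rewrite /quad_pair /= nth_index //=; lia.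
apply/row_fullP; exists (\matrix_(k, p) ((p == idx k)%:R /
   (1 + ((quad_pair p).1 < (quad_pair p).2)%N%:R))).
apply/matrixP => k k'; rewrite !mxE (bigD1 (idx k)) //= big1 ?addr0 => [|p /negPf pk]; last first.
  by rewrite !mxE pk !mul0r.
rewrite !mxE /= eqxx idxP mul1r mulrC -mulrA mulfV ?mulr1 //.
by rewrite addrC natr1 pnatr_eq0.
Qed.

Definition projection_mx : 'M[K]_(N.+1, n.+1) := square_mx *m invmx g^T.

Lemma projection_mx_full : row_full projection_mx.
Proof.
have /row_fullP [B BE] := square_mx_full; apply/row_fullP; exists (g^T *m B).
by rewrite /projection_mx mulmxA -(mulmxA g^T) BE mulmx1 mulmxV // trU.
Qed.

Lemma veronese_projection u :
  quad_veronese_vec u *m projection_mx = of_form g (rVpoly u ^+ 2).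
Proof. by rewrite mulmxA veronese_square_mx. Qed.

Lemma size_sqr_leq (q : {poly K}) : (size q <= r.+1)%N -> (size (q ^+ 2) <= n.+1)%N.
Proof. by move=> qs; rewrite expr2 (leq_trans (size_polyMleq _ _)) //; lia. Qed.

Lemma rVpoly_eq0 d (u : 'rV[K]_d) : (rVpoly u == 0) = (u == 0).
Proof.
apply/eqP/eqP => [u0|->]; last by rewrite linear0.
by rewrite -[u]rVpolyK u0 linear0.
Qed.

Lemma form_of_square u : form_of g (of_form g (rVpoly u ^+ 2)) = rVpoly u ^+ 2.
Proof. by rewrite of_formK // size_sqr_leq // size_poly. Qed.

Lemma of_form_square_neq0 u : u != 0 -> of_form g (rVpoly u ^+ 2) != 0.
Proof. by move=> u0; rewrite -(form_of_eq0 gU) form_of_square expf_eq0 /= rVpoly_eq0. Qed.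

Lemma quad_veronese_vec_neq0 u : u != 0 -> quad_veronese_vec u != 0.
Proof.
move=> /of_form_square_neq0; rewrite -veronese_projection.
by apply: contraNneq => ->; rewrite mul0mx.
Qed.

Lemma quad_veronese_vecZ (c : K) u : quad_veronese_vec (c *: u) = c ^+ 2 *: quad_veronese_vec u.
Proof. by apply/rowP => p; rewrite !mxE /= !mxE mulrACA. Qed.

Lemma line_scale (vT : vectType K) (c : K) (v : vT) : c != 0 -> <[c *: v]>%VS = <[v]>%VS.
Proof.
move=> c0; apply/eqP; rewrite eqEdim -memvE memvZ ?memv_line // !dim_vline.
by rewrite scaler_eq0 negb_or c0 /= leqnn.
Qed.

(** Proportional squares have proportional roots, up to sign; this makes the inverse map well
    defined. *)
Lemma square_line_inj u w : u != 0 ->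
  <[of_form g (rVpoly u ^+ 2)]>%VS = <[of_form g (rVpoly w ^+ 2)]>%VS ->
  <[quad_veronese_vec u]>%VS = <[quad_veronese_vec w]>%VS.
Proof.
move=> u0 E; have /vlineP [c cE] : of_form g (rVpoly u ^+ 2) \in <[of_form g (rVpoly w ^+ 2)]>%VS.
  by rewrite -E memv_line.
have : rVpoly u ^+ 2 = (sqrtC c *: rVpoly w) ^+ 2.
  by rewrite exprZn sqrtCK -form_of_square cE form_ofZ form_of_square.
move/eqP; rewrite eqf_sqr => uw.
have [e uE] : exists e, u = e *: w.
  case/orP: uw => /eqP/(congr1 (@poly_rV K r.+1)); rewrite ?linearN linearZ /= !rVpolyK => ->.
    by exists (sqrtC c).
  by exists (- sqrtC c); rewrite scaleNr.
rewrite uE quad_veronese_vecZ line_scale // expf_neq0 //.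
by apply: contraNneq u0 => e0; rewrite uE e0 scale0r.
Qed.

Lemma projection_exists : exists phi : pspace K N -> pspace K n, forall x u, u != 0 ->
  val x = <[quad_veronese_vec u]>%VS ->
  val (phi x) = <[of_form g (rVpoly u ^+ 2)]>%VS /\
  val (phi x) = (linfun (mulmxr projection_mx) @: val x)%VS.
Proof.
suff /choice [phi phiP] (x : pspace K N) : exists z : pspace K n, forall u, u != 0 ->
    val x = <[quad_veronese_vec u]>%VS ->
    val z = <[of_form g (rVpoly u ^+ 2)]>%VS /\
    val z = (linfun (mulmxr projection_mx) @: val x)%VS.
  by exists phi.
have imE u : (linfun (mulmxr projection_mx) @: <[quad_veronese_vec u]>)%VS =
    <[of_form g (rVpoly u ^+ 2)]>%VS.
  by rewrite limg_line lfunE /= veronese_projection.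
have [[u u0 xu]|H] := pselect (exists2 u, u != 0 & val x = <[quad_veronese_vec u]>%VS).
  exists (pline (of_form_square_neq0 u0)) => w w0 xw; rewrite xw imE /=; split=> //;
  by rewrite -!imE -xu xw.
(* An arbitrary value off the Veronese variety, since the map must be total. *)
have d0 : delta_mx 0 0 != 0 :> 'rV[K]_n.+1.
  by apply/rV0Pn; exists 0; rewrite mxE !eqxx oner_eq0.
by exists (pline d0) => u u0 xu; exfalso; apply: H; exists u.
Qed.

Lemma inverse_exists : exists psi : pspace K n -> pspace K N, forall y u, u != 0 ->
  val y = <[of_form g (rVpoly u ^+ 2)]>%VS -> val (psi y) = <[quad_veronese_vec u]>%VS.
Proof.
have H (y : pspace K n) : exists z : pspace K N, forall u, u != 0 ->
    val y = <[of_form g (rVpoly u ^+ 2)]>%VS -> val z = <[quad_veronese_vec u]>%VS.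
  have [[u u0 yu]|H] := pselect (exists2 u : 'rV[K]_r.+1, u != 0 & val y = <[of_form g (rVpoly u ^+ 2)]>%VS).
    exists (pline (quad_veronese_vec_neq0 u0)) => w w0 yw /=.
    by apply: square_line_inj; rewrite -?yu.
  have d0 : delta_mx 0 0 != 0 :> 'rV[K]_N.+1.
    by apply/rV0Pn; exists 0; rewrite mxE !eqxx oner_eq0.
  by exists (pline d0) => u u0 yu; exfalso; apply: H; exists u.
by have [psi psiP] := choice H; exists psi.
Qed.

Lemma square_form_vec a : a != 0 -> square_form g a ->
  exists2 u : 'rV[K]_r.+1, u != 0 & a = of_form g (rVpoly u ^+ 2).
Proof.
move=> a0 [q qs aq]; have uE : rVpoly (poly_rV q : 'rV_r.+1) = q by rewrite poly_rV_K.
have aE : a = of_form g (q ^+ 2) by rewrite -aq form_ofK.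
exists (poly_rV q); rewrite ?uE //; apply: contraNneq a0 => u0.
by rewrite aE -uE u0 linear0 expr0n /of_form linear0 mul0mx.
Qed.

(* The square root of the form of [a], divided by its value at [c]. *)
Definition local_root c a : {poly K} := psqrt (normal_form g c a) r \Po ('X - c%:P).

Lemma regular_off_local_root c k : regular_off g c (fun a => (local_root c a)`_k).
Proof.
apply: (eq_regular_off (Y := fun a => \sum_(i < r.+1)
    (psqrt (normal_form g c a) r)`_i * (('X - c%:P) ^+ i)`_k)).
  move=> a _; rewrite /local_root; set P := psqrt _ _.
  have -> : P = \poly_(i < r.+1) P`_i.
    apply/polyP => i; rewrite coef_poly; case: ltnP => // ri.
    by apply: nth_default; apply: leq_trans ri; apply: size_psqrt.
  rewrite [X in X \Po _]poly_def raddf_sum coef_sum; apply: eq_bigr => i _ /=.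
  by rewrite comp_polyZ comp_Xn_poly coefZ coef_poly ltn_ord.
apply: regular_off_sum => i; apply: regular_offM; first exact: regular_off_psqrt.
exact: regular_off_const.
Qed.

Lemma local_rootE c u : (rVpoly u).[c] != 0 ->
  local_root c (of_form g (rVpoly u ^+ 2)) = (rVpoly u).[c]^-1 *: rVpoly u.
Proof.
move=> uc; rewrite /local_root (psqrt_normal_form (form_of_square u)) ?size_poly //.
by rewrite comp_polyZ comp_XaddCK.
Qed.

(** The products of coefficients of [u] divided by its value at [c] are regular functions of the
    square; a common denominator turns them into forms of one degree. *)
Lemma regular_inverse_forms c : exists d (F : 'I_N.+1 -> {mpoly K[n.+1]}),
  (forall p, F p \is d.-homog) /\
  forall u, (rVpoly u).[c] != 0 -> exists2 s, s != 0 &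
    eval_forms F (of_form g (rVpoly u ^+ 2)) = s *: quad_veronese_vec u.
Proof.
have [d [F [Fd FY]]] := @regular_off_common _ _ g c _ (fun p a =>
    (local_root c a)`_(quad_pair p).1 * (local_root c a)`_(quad_pair p).2)
  (fun p => regular_offM (regular_off_local_root c _) (regular_off_local_root c _)).
exists d, F; split=> // u uc; set x := (rVpoly u).[c] in uc.
(* The common denominator contributes the d-th power of the value [x ^+ 2] of the square, and the
   two normalized roots contribute [x^-1] each. *)
exists ((x ^+ 2) ^+ d * (x^-1) ^+ 2).
  by rewrite mulf_neq0 ?expf_neq0 ?invr_eq0.
apply/rowP => p; rewrite !mxE FY form_of_square horner_exp ?expf_neq0 //.
rewrite local_rootE // !coefZ -/x /= -/(quad_pair p) !coef_rVpoly_ord -[RHS]mulrA.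
by congr (_ * _); rewrite mulrACA expr2.
Qed.

Variable C : set (pspace K n).
Hypothesis CE : C = [set x | exists2 u : 'rV[K]_2, u != 0 &
                   val x = <[veronese_curve_vec n u *m g]>%VS].
Local Notation Y := (dual_variety (secant_variety r C)).

Lemma dual_point (y : pspace K n) v : Y y -> v \in val y -> v != 0 ->
  exists2 u : 'rV[K]_r.+1, u != 0 & v = of_form g (rVpoly u ^+ 2) /\ val y = <[v]>%VS.
Proof.
move=> Yy vy v0; have [w w0 yw] := pspace_gen y.
have yE : val y = <[v]>%VS.
  move: vy; rewrite yw => /vlineP [k vE]; rewrite vE line_scale //.
  by apply: contraNneq v0 => k0; rewrite vE k0 scale0r.
have /(square_form_vec v0) [u u0 vE] : square_form g v.
  by apply: (iffLR (dual_secant_variety r_gt0 gU CE yE)).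
by exists u.
Qed.

Lemma veronese_projection_isomorphism :
  exists2 phi : pspace K N -> pspace K n,
    restricts_projection projection_mx (@quad_veronese K r) phi &
    isomorphism_onto (@quad_veronese K r) Y phi.
Proof.
have [phi phiE] := projection_exists; have [psi psiE] := inverse_exists.
exists phi; first by move=> x [u u0 xu]; case: (phiE x u u0 xu).
exists psi; split.
- move=> x [u u0 xu]; have [yu _] := phiE x u u0 xu; split.
    apply: (iffRL (dual_secant_variety r_gt0 gU CE yu)).
    by exists (rVpoly u); [exact: size_poly|rewrite form_of_square].
  by apply: val_inj; rewrite (psiE _ u u0 yu) xu.
- move=> y Yy; have [w w0 yw] := pspace_gen y.
  have wy : w \in val y by rewrite yw memv_line.
  have [u u0 [wE yE]] := dual_point Yy wy w0; rewrite wE in yE.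
  have xu := psiE _ u u0 yE; split; first by exists u.
  by apply: val_inj; have [-> _] := phiE _ u u0 xu; rewrite yE.
(* Linear forms work globally, so the excluded closed set is the empty locus of 1. *)
- move=> x _; exists 1%N, (fun k => \sum_p projection_mx p k *: 'X_p), (zlocus [set 1]); split.
  + by move=> k; apply: rpred_sum => p _; rewrite rpredZ // dhomogX /= mdeg1.
  + exact: zlocus_zclosed.
  + move=> /(_ 1 erefl); have [v v0 xv] := pspace_gen x => /(_ v).
    by rewrite xv memv_line meval1 => /(_ isT)/eqP; rewrite oner_eq0.
  + move=> y [u u0 yu] _ v; rewrite yu => /vlineP [k ->] kv.
    have [-> _] := phiE y u u0 yu.
    have -> : eval_forms (fun k => \sum_p projection_mx p k *: 'X_p) (k *: quad_veronese_vec u) =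
        k *: of_form g (rVpoly u ^+ 2).
      rewrite -veronese_projection scalemxAl; apply/rowP => j; rewrite mxE raddf_sum mxE.
      by apply: eq_bigr => p _ /=; rewrite mevalZ mevalXU mulrC.
    by rewrite line_scale //; apply: contraNneq kv => ->; rewrite scale0r.
- move=> y0 Yy0; have [w w0 yw] := pspace_gen y0.
  have [c wc] : exists c, (form_of g w).[c] != 0 by apply: poly_nonroot; rewrite form_of_eq0.
  have [d [F [Fd FE]]] := regular_inverse_forms c.
  (* The neighbourhood consists of the forms not vanishing at [c], a point chosen off the roots of
     the given form. *)
  exists d, F, (zlocus [set scalar_form g (fun p => p.[c])]); split=> //.
  + exact: zlocus_zclosed.
  + move=> /(_ _ erefl w); rewrite yw memv_line ev_eval_form => /(_ isT).
    exact/eqP.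
  + move=> y Yy yZ v vy v0; have [u u0 [vE yE]] := dual_point Yy vy v0.
    have uc : (rVpoly u).[c] != 0.
      apply/eqP => uc; apply: yZ => _ -> v'; rewrite yE => /vlineP [k ->].
      by rewrite ev_eval_form form_ofZ vE form_of_square hornerZ horner_exp uc expr0n mulr0.
    have [s s0] := FE u uc; rewrite -vE => ->.
    by rewrite line_scale // (psiE _ u u0) // yE vE.
Qed.

End VeroneseProjection.

Theorem mainTheorem12 (R : realType) (r : nat) (r_ge1 : (1 <= r)%N)
    (C : set (pspace R[i] (2 * r)))
    (ratC : rational_normal_curve C) :
  exists2 A : 'M[R[i]]_((quad_dim r).+1, (2 * r).+1),
    row_full A &
    exists2 phi : pspace R[i] (quad_dim r) -> pspace R[i] (2 * r),
      restricts_projection A (@quad_veronese R[i] r) phi &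
      isomorphism_onto (@quad_veronese R[i] r)
                       (dual_variety (secant_variety r C)) phi.
Proof.
have [g gU CE] := ratC.
exists (projection_mx g); first exact: projection_mx_full.
exact: veronese_projection_isomorphism r_ge1 gU _ CE.
Qed.
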